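(* For every $\epsilon\in(0,1)$ there exists a constant $C$ depending only on $\epsilon$ such that $$\sup_{z\in\mathbb{R}}\big|\mathbb{P}_{n,\alpha}[W\le z]-\mathbb{P}[Z\le z]\big|\le\frac{C\sqrt{\alpha}}{n}\qquad\text{for all integers } n\ge 2\text{ and all real }\alpha\ge n^{1+\epsilon},$$ where $Z$ is a standard normal random variable and $$W=\frac{Y}{\sqrt{\alpha\binom n2}},\qquad Y=\sum_{x\in\Lambda_n}c_\alpha(x),$$ with $\Lambda_n$ a random partition of $n$ sampled from the $\mathrm{Jack}_\alpha$ measure.
   Context: A partition $\Lambda=(\lambda_1,\dots,\lambda_p)$ of $n$ (non-increasing positive integers summing to $n$) is identified with its diagram (tableau) of $n$ boxes, in which the $j$-th row has $\lambda_j$ boxes, rows being left-justified and numbered from top to bottom. For a box $x$ in $\Lambda$, $a(x)$ is the number of boxes in the same row as $x$ and to the right of $x$, and $l(x)$ is the number of boxes in the same column as $x$ and below $x$. For $\alpha>0$, the $\mathrm{Jack}_\alpha$ measure on partitions of $n$ is $$\mathrm{Jack}_\alpha(\Lambda)=\frac{\alpha^n n!}{\prod_{x\in\Lambda}(\alpha a(x)+l(x)+1)(\alpha a(x)+l(x)+\alpha)} ,$$ the product being over all boxes $x$ of $\Lambda$. The $\alpha$-content of a box $x$ is $c_\alpha(x)=\alpha\,(\text{column number of }x-1)-(\text{row number of }x-1)$. $\mathbb{P}_{n,\alpha}$ denotes probability when $\Lambda_n$ is $\mathrm{Jack}_\alpha$-distributed on partitions of $n$. *)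

(* Defs.v *)
From HB Require Import structures.
From mathcomp Require Import all_boot all_order all_algebra.
From mathcomp Require Import all_classical all_reals all_analysis.

Set Implicit Arguments.
Unset Strict Implicit.
Unset Printing Implicit Defensive.

Import Order.TTheory GRing.Theory Num.Theory.

Local Open Scope ring_scope.

Definition is_intpart (n : nat) (s : seq nat) : bool :=
  [&& sorted geq s, all (leq 1) s & sumn s == n].

(* A partition of n has at most n parts, each of size at most n; this bounded
   encoding is only there to make the type finite. *)
Record intpart (n : nat) := IntPart {
  bparts : {bseq n of 'I_n.+1};
  _ : is_intpart n [seq val i | i <- bparts] }.

HB.instance Definition _ n := [isSub for @bparts n].
HB.instance Definition _ n := [Finite of intpart n by <:].

Definition parts (n : nat) (L : intpart n) : seq nat :=
  [seq val i | i <- bparts L].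

(* Boxes are pairs (row, column), both numbered from 0. *)
Definition boxes (n : nat) (L : intpart n) : seq (nat * nat) :=
  [seq (i, j) | i <- iota 0 (size (parts L)), j <- iota 0 (nth 0%N (parts L) i)].

Definition arm (n : nat) (L : intpart n) (x : nat * nat) : nat :=
  count (fun y => (y.1 == x.1) && (x.2 < y.2)%N) (boxes L).

Definition leg (n : nat) (L : intpart n) (x : nat * nat) : nat :=
  count (fun y => (y.2 == x.2) && (x.1 < y.1)%N) (boxes L).

Definition jack (R : realType) (n : nat) (alpha : R) (L : intpart n) : R :=
  alpha ^+ n * n`!%:R /
  \prod_(x <- boxes L)
     ((alpha * (arm L x)%:R + (leg L x)%:R + 1) *
      (alpha * (arm L x)%:R + (leg L x)%:R + alpha)).

Definition jack_prob (R : realType) (n : nat) (alpha : R)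
    (A : pred (intpart n)) : R :=
  \sum_(L : intpart n | A L) jack alpha L.

Definition content (R : realType) (alpha : R) (x : nat * nat) : R :=
  alpha * x.2%:R - x.1%:R.

Definition jackY (R : realType) (n : nat) (alpha : R) (L : intpart n) : R :=
  \sum_(x <- boxes L) content alpha x.

Definition jackW (R : realType) (n : nat) (alpha : R) (L : intpart n) : R :=
  jackY alpha L / Num.sqrt (alpha * 'C(n, 2)%:R).

(* Main.v *)
Require Import Defs.
From HB Require Import structures.
From mathcomp Require Import all_boot all_order all_algebra.
From mathcomp Require Import all_classical all_reals all_analysis.
From mathcomp Require Import ring lra zify.

(** Let sigma ^ 2 = alpha * 'C(n, 2), the variance of the content sum Y under the
Jack measure. The proof is Stein's method in its zero-bias form, applied to the
last step of the growth process of Jack diagrams.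

A Jack diagram of size n - 1, with content sum V, becomes a Jack diagram of size n
when a box is added with Kerov's transition probabilities [upw]; if X is the content
of the new box then Y = V + X. Three facts carry the argument. Given the smaller
diagram, X has mean 0 and variance alpha * (n - 1), a constant ([upw_moment]).
Given the larger one, the mean of X is 2 * Y / n ([downw_mean],
[expect_grow_content]). Finally |X| is of order alpha, because rows of length
greater than a constant L depending on eps are unlikely when alpha >= n ^ (1 + eps)
([expect_long_rows], [long_row_tail]).

The first two facts are residue computations: the moments of the transition weights,
in both directions, are symmetric functions of the contents of the free positions
of the rows ([residue_sum_hsym]). That the two directions describe the same joint law,
[detailed_balance], comes from writing the ratio of the hook products of two
neighbouring diagrams in terms of these contents ([hook_incr]); this also yields
that the Jack measure has mass 1 ([expect1]).

The first two facts give, for every f,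
E[Y f (Y / sigma)] = (n / 2) * E[X (f ((V + X) / sigma) - f (V / sigma))]. The
right-hand side is sigma times the expectation of f' at a random point of the
segment from V / sigma to (V + X) / sigma: this random point is the zero-biased
version of Y / sigma. Its distribution function Q is compared with Phi and with that
of Y / sigma. For Phi, insert the solution f of Stein's equation
f' w - w f w = 1_(w <= z) - Phi z. Its indicator turns into Q z, so what is left is
the difference between w f w at two points a distance of order delta apart, where
delta = alpha * L / sigma, and w f w is locally Lipschitz ([zbcdf_Phi]). For
Y / sigma, the sandwich Q (z - 2 delta) <= P (Y / sigma <= z) <= Q (z + 2 delta)
holds up to the probability of a long row ([zero_bias_kolmogorov]). As delta is of
order sqrt alpha / n, and a long row has probability at most 1 / n, the theorem
follows. *)

Set Implicit Arguments.
Unset Strict Implicit.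
Unset Printing Implicit Defensive.

Import Order.TTheory GRing.Theory Num.Theory.
Import numFieldNormedType.Exports.

Local Open Scope classical_set_scope.
Local Open Scope ring_scope.

(** * Residue sums at distinct poles *)

(** The sum of the residues of z ^ k * prod_Y (z - y) / prod_X (z - x): the
moments of a transition measure whose Cauchy transform has its poles at X and its
zeros at Y. *)
Definition residue_sum (R : realFieldType) (X Y : seq R) (k : nat) : R :=
  \sum_(x <- X) x ^+ k * \prod_(y <- Y) (x - y) / \prod_(x' <- X | x' != x) (x - x').

Definition powsum (R : realFieldType) (k : nat) (X Y : seq R) : R :=
  \sum_(x <- X) x ^+ k - \sum_(y <- Y) y ^+ k.

(** The complete homogeneous symmetric function of degree e <= 3 of the difference
of alphabets X - Y, written in power sums by Newton's identities. *)
Definition hsym (R : realFieldType) (X Y : seq R) (e : nat) : R :=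
  let p k := powsum k X Y in
  match e with
  | 0%N => 1
  | 1%N => p 1%N
  | 2%N => (p 1%N ^+ 2 + p 2%N) / 2%:R
  | 3%N => (p 1%N ^+ 3 + 3%:R * p 1%N * p 2%N + 2%:R * p 3%N) / 6%:R
  | _ => 0
  end.

Lemma residue_sum_cons_num (R : realFieldType) (X Y : seq R) y k :
  residue_sum X (y :: Y) k = residue_sum X Y k.+1 - y * residue_sum X Y k.
Proof.
rewrite /residue_sum mulr_sumr -sumrB; apply: eq_bigr => x _.
by rewrite big_cons exprSr; ring.
Qed.

Lemma residue_sum_perm (R : realFieldType) (X X' Y : seq R) k :
  perm_eq X X' -> residue_sum X Y k = residue_sum X' Y k.
Proof.
move=> XX'; rewrite /residue_sum (perm_big _ XX').
by apply: eq_bigr => x _; rewrite (perm_big _ XX').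
Qed.

(** Multiplying by x - x0 cancels the pole at x0; together with [residue_sum_cons_num]
this lets poles and zeros be added one at a time. *)
Lemma residue_sum_cons_den (R : realFieldType) (X Y : seq R) x0 k : uniq (x0 :: X) ->
  residue_sum (x0 :: X) Y k.+1 = residue_sum X Y k + x0 * residue_sum (x0 :: X) Y k.
Proof.
move=> /= /andP[x0X uX]; rewrite /residue_sum mulr_sumr !big_cons addrCA.
rewrite exprS -!mulrA; congr (_ + _).
rewrite big_seq [X in _ = X + _]big_seq [X in _ = _ + X]big_seq.
rewrite -big_split /=; apply: eq_bigr => x xX.
have xx0 : x - x0 != 0 by rewrite subr_eq0; apply: contraNneq x0X => <-.
have -> : \prod_(x' <- x0 :: X | x' != x) (x - x')
  = (x - x0) * \prod_(x' <- X | x' != x) (x - x').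
  by rewrite big_cons eq_sym -subr_eq0 xx0.
have d0 : \prod_(x' <- X | x' != x) (x - x') != 0.
  by rewrite prodf_seq_neq0; apply/allP => x' _; apply/implyP; rewrite subr_eq0 eq_sym.
by rewrite exprS; field; rewrite xx0 d0.
Qed.

(** Removing either of two poles from the same sum and comparing the results gives
the recursion of divided differences. *)
Lemma residue_sum_divided_difference (R : realFieldType) (X Y : seq R) x0 x1 k :
  uniq [:: x0, x1 & X] ->
  (x0 - x1) * residue_sum [:: x0, x1 & X] Y k = residue_sum (x0 :: X) Y k - residue_sum (x1 :: X) Y k.
Proof.
move=> u01.
have p01 : perm_eq [:: x0, x1 & X] [:: x1, x0 & X].
  by apply/permP => a /=; rewrite addnCA.
have u10 : uniq [:: x1, x0 & X] by rewrite -(perm_uniq p01).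
have := residue_sum_cons_den Y k u10; rewrite -!(residue_sum_perm _ _ p01).
by rewrite (residue_sum_cons_den Y k u01) => E; lra.
Qed.

Lemma residue_sum_singleton (R : realFieldType) (x : R) : residue_sum [:: x] [::] 0 = 1.
Proof. by rewrite /residue_sum big_seq1 big_nil big_cons big_nil eqxx !mulr1 divr1. Qed.

Lemma residue_sum_constant (R : realFieldType) (X : seq R) : uniq X -> (1 < size X)%N ->
  residue_sum X [::] 0 = 0.
Proof.
have [n] := ubnP (size X); elim: n X => // n IH [//|x0 [//|x1 X]] sX u01 _.
have x01 : x0 - x1 != 0.
  by move: u01 => /= /andP[]; rewrite inE negb_or subr_eq0 => /andP[].
apply: (mulfI x01); rewrite residue_sum_divided_difference // mulr0.
move: u01 => /= /and3P[]; rewrite inE negb_or => /andP[_ x0X] x1X uX.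
case: X => [|x2 X] in sX x0X x1X uX *.
  by rewrite !residue_sum_singleton subrr.
rewrite !IH //= ?subrr //; first by rewrite x1X.
by rewrite x0X.
Qed.

Lemma powsum_cons_num (R : realFieldType) (X Y : seq R) y k :
  powsum k X (y :: Y) = powsum k X Y - y ^+ k.
Proof. by rewrite /powsum big_cons opprD addrCA addrC. Qed.

Lemma powsum_cons_den (R : realFieldType) (X Y : seq R) x k :
  powsum k (x :: X) Y = powsum k X Y + x ^+ k.
Proof. by rewrite /powsum big_cons -addrA addrC. Qed.

Lemma hsym_cons_den (R : realFieldType) (X Y : seq R) x e : (e < 3)%N ->
  hsym (x :: X) Y e.+1 = hsym X Y e.+1 + x * hsym (x :: X) Y e.
Proof.
by case: e => [|[|[|//]]] _; rewrite /hsym !powsum_cons_den; field.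
Qed.

Lemma hsym_cons_num (R : realFieldType) (X Y : seq R) y e : (e < 3)%N ->
  hsym X (y :: Y) e.+1 = hsym X Y e.+1 - y * hsym X Y e.
Proof.
by case: e => [|[|[|//]]] _; rewrite /hsym !powsum_cons_num; field.
Qed.

(** Both sides obey the same recursions when a pole or a zero is added, so induction
on Y, then on k and X, reduces the identity to [residue_sum_constant]. Sums of negative
total degree vanish; carrying that case along makes the induction go through. *)
Lemma residue_sum_hsym_ext (R : realFieldType) (X Y : seq R) k d :
    uniq X -> (k + size Y).+1 = d -> (d <= size X + 3)%N ->
  residue_sum X Y k = if (d < size X)%N then 0 else hsym X Y (d - size X).
Proof.
move=> + <-{d}; elim: Y k => [|y Y IHY] k uX /= sX; last first.
  rewrite residue_sum_cons_num !IHY //=; [|by lia|by rewrite addSnnS].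
  rewrite addnS; set d := (k + size Y)%N in sX *.
  have -> : (k.+1 + size Y)%N = d.+1 by rewrite /d; lia.
  case: (ltngtP d.+2 (size X)) => [d2X|Xd2|d2X].
  - by ring.
  - have -> : (d.+2 - size X = (d.+1 - size X).+1)%N by lia.
    by rewrite hsym_cons_num //; rewrite /d; lia.
  - by rewrite -d2X subnn /=; ring.
rewrite /= addn0 in sX *.
elim: k X uX sX => [|k IH] [|x0 X] uX sX.
- by rewrite /residue_sum big_nil /hsym /powsum !big_nil /= subrr.
- case: X uX sX => [_ _|x1 X uX _]; last exact: residue_sum_constant.
  by rewrite residue_sum_singleton.
- rewrite /residue_sum big_nil /hsym /powsum !big_nil /= subrr.
  by case: k {IH} sX => [|[|//]] _ /=; rewrite ?expr0n /=; ring.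
- have uX' : uniq X by move: uX; rewrite cons_uniq => /andP[].
  rewrite /= in sX; rewrite residue_sum_cons_den // !IH //=; last exact: ltnW.
  rewrite !subSS !ltnS.
  have [kX|Xk|kX] := ltngtP k.+1 (size X).
  + by ring.
  + have -> : (k.+1 - size X = (k - size X).+1)%N by lia.
    by rewrite hsym_cons_den //; lia.
  + by rewrite -kX subnn /=; ring.
Qed.

Lemma residue_sum_hsym (R : realFieldType) (X Y : seq R) k e : uniq X -> (e <= 3)%N ->
  (k + size Y).+1 = (size X + e)%N -> residue_sum X Y k = hsym X Y e.
Proof.
move=> uX e3 kY; rewrite (residue_sum_hsym_ext uX kY) ?leq_add2l //.
by rewrite ltnNge leq_addr /= addKn.
Qed.

(** * The hook ratio of two neighbouring diagrams *)

(** With u = alpha * a + l, the factor contributed by a box of arm a and leg l to the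
denominator of the Jack measure. *)
Definition hookpair (R : realFieldType) (alpha u : R) : R := (u + 1) * (u + alpha).

(** The hook factors of a row of length m lying above the rows s, with all legs
shifted by u. The boxes are indexed by their arm d: the box of arm d is in column
m - 1 - d, so the rows below reaching that column are those with m <= q + d. The
shift u is what makes the product stable under removal of the first row of s. *)
Definition rowhook (R : realFieldType) (alpha : R) (m : nat) (s : seq nat) (u : R) : R :=
  \prod_(d <- iota 0 m)
    hookpair alpha (alpha * d%:R + (count (fun q => m <= q + d)%N s)%:R + u).

Fixpoint hook (R : realFieldType) (alpha : R) (s : seq nat) : R :=
  if s is m :: s' then rowhook alpha m s' 0 * hook alpha s' else 1.

(** The alpha-content of the first free position of row k. *)
Definition xrow (R : realFieldType) (alpha : R) (s : seq nat) (k : nat) : R :=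
  alpha * (nth 0%N s k)%:R - k%:R.

Definition addable (s : seq nat) (r : nat) : bool :=
  (r == 0%N) || (nth 0%N s r < nth 0%N s r.-1)%N.

Lemma iota0S n : iota 0 n.+1 = 0%N :: map S (iota 0 n).
Proof. by rewrite /= -[1%N]/(1 + 0)%N iotaDl. Qed.

Lemma iota0Sr n : iota 0 n.+1 = rcons (iota 0 n) n.
Proof. by rewrite -addn1 iotaD cats1. Qed.

Lemma sorted_geq_cons m s : sorted geq (m :: s) ->
  all (fun q => q <= m)%N s /\ sorted geq s.
Proof.
move=> ms; split; last exact: path_sorted ms.
by have /order_path_min := ms; apply=> a b c ab bc; exact: leq_trans bc ab.
Qed.

Lemma hookpair_gt0 (R : realFieldType) (alpha u : R) : 0 < alpha -> 0 <= u ->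
  0 < hookpair alpha u.
Proof. by move=> *; rewrite /hookpair; apply: mulr_gt0; lra. Qed.

Lemma rowhook_gt0 (R : realFieldType) (alpha : R) m s u : 0 < alpha -> 0 <= u ->
  0 < rowhook alpha m s u.
Proof.
move=> a0 u0; apply: prodr_gt0 => d _; apply: hookpair_gt0 => //.
by rewrite !addr_ge0 // mulr_ge0 // ltW.
Qed.

Lemma hook_gt0 (R : realFieldType) (alpha : R) s : 0 < alpha -> 0 < hook alpha s.
Proof. by move=> a0; elim: s => //= m s IH; rewrite mulr_gt0 // rowhook_gt0. Qed.

(** The d < m - q rightmost boxes overhang the next row, so their legs are zero;
the other boxes see the row q as if they belonged to it, with u shifted. *)
Lemma rowhook_cons (R : realFieldType) (alpha : R) m q s u :
  (q <= m)%N -> all (fun p => p <= q)%N s ->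
  rowhook alpha m (q :: s) u =
  (\prod_(d <- iota 0 (m - q)) hookpair alpha (alpha * d%:R + u)) *
  rowhook alpha q s (u + 1 + alpha * (m - q)%:R).
Proof.
move=> qm sq; rewrite /rowhook -{1}(subnK qm) iotaD big_cat /=; congr (_ * _).
  apply: eq_big_seq => d; rewrite mem_iota /= => dmq.
  congr hookpair; rewrite (_ : count _ _ = 0%N); last first.
    rewrite -[RHS](count_pred0 s); apply: eq_in_count => p /(allP sq) pq /=.
    by lia.
  by rewrite (_ : (m <= q + d)%N = false) ?addr0 //; lia.
rewrite add0n -[X in iota X _]addn0 iotaDl big_map.
apply: eq_bigr => d _; congr hookpair.
rewrite (_ : (m <= q + (m - q + d))%N); last by lia.
rewrite (_ : count _ s = count (fun p => q <= p + d)%N s); last first.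
  by apply: eq_count => p; lia.
by rewrite /= !natrD; ring.
Qed.

Lemma rowhookS (R : realFieldType) (alpha : R) m s u :
  all (fun p => p <= m)%N s ->
  rowhook alpha m.+1 s u = hookpair alpha u * rowhook alpha m s (u + alpha).
Proof.
move=> sm; rewrite /rowhook iota0S big_cons big_map; congr (_ * _).
  congr hookpair; rewrite (_ : count _ _ = 0%N) ?mulr0 ?add0r //.
  rewrite -[RHS](count_pred0 s); apply: eq_in_count => p /(allP sm) /= pq; lia.
apply: eq_bigr => d _; congr hookpair.
rewrite (_ : count _ s = count (fun p => m <= p + d)%N s); last first.
  by apply: eq_count => p; lia.
by rewrite -natr1; ring.
Qed.

Lemma hookpair_row_telescope (R : realFieldType) (alpha : R) m u :
  (\prod_(d <- iota 0 m) hookpair alpha (alpha * d%:R + (u + alpha))) * hookpair alpha u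
  = (\prod_(d <- iota 0 m) hookpair alpha (alpha * d%:R + u)) * hookpair alpha (alpha * m%:R + u).
Proof.
have E : \prod_(d <- iota 0 m.+1) hookpair alpha (alpha * d%:R + u) =
  (\prod_(d <- iota 0 m) hookpair alpha (alpha * d%:R + (u + alpha))) * hookpair alpha u.
  rewrite iota0S big_cons big_map mulr0 add0r mulrC; congr (_ * _).
  by apply: eq_bigr => d _; congr hookpair; rewrite -natr1; ring.
by rewrite -E iota0Sr big_rcons /= mulrC.
Qed.

Lemma hookpair_column_telescope (R : realFieldType) (alpha : R) N v :
  0 < alpha -> 0 <= v ->
  hookpair alpha (v + N%:R) *
    \prod_(k <- iota 0 N) (hookpair alpha (v + k%:R) / hookpair alpha (v + k%:R + 1))
  = hookpair alpha v.
Proof.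
move=> a0 v0; elim: N => [|N IH]; first by rewrite big_nil addr0 mulr1.
rewrite iota0Sr big_rcons /= -[in RHS]IH -natr1 addrA.
have : hookpair alpha (v + N%:R + 1) != 0.
  by rewrite gt_eqF // hookpair_gt0 // !addr_ge0.
by move=> h; field.
Qed.

(** Going around the boundary of the diagram below the row, each step to the left
raises alpha * a + l by alpha and each step down raises it by 1. The product of
[hookpair] ratios along this path telescopes; the induction follows the path row by
row. *)
Lemma rowhook_ratio (R : realFieldType) (alpha : R) m s N u :
  0 < alpha -> 0 <= u -> sorted geq (m :: s) -> (size s <= N)%N ->
  rowhook alpha m.+1 s u = rowhook alpha m s u * (hookpair alpha (alpha * m%:R + N%:R + u) *
   \prod_(k <- iota 0 N)
     (hookpair alpha (alpha * (m%:R - (nth 0%N s k)%:R) + k%:R + u) /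
      hookpair alpha (alpha * (m%:R - (nth 0%N s k)%:R) + k%:R + 1 + u))).
Proof.
move=> a0; elim: s m N u => [|q s IH] m N u u0 /sorted_geq_cons[sm ss] sN.
  have am : 0 <= alpha * m%:R + u by rewrite addr_ge0 // mulr_ge0 // ltW.
  rewrite rowhookS // addrAC (eq_bigr (fun k => (hookpair alpha (alpha * m%:R + u + k%:R) /
     hookpair alpha (alpha * m%:R + u + k%:R + 1)))); last first.
    by move=> k _; rewrite nth_nil subr0; congr (hookpair _ _ / hookpair _ _); ring.
  rewrite hookpair_column_telescope // mulrC /rowhook.
  under eq_bigr do rewrite /= addr0.
  under [in RHS]eq_bigr do rewrite /= addr0.
  exact: hookpair_row_telescope.
case: N sN => // N sN; have /andP[qm sqm] := sm.
have [sq ss'] := sorted_geq_cons ss.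
rewrite rowhookS // !rowhook_cons //.
set u' := u + 1 + alpha * (m - q)%:R.
have u'0 : 0 <= u' by rewrite !addr_ge0 // mulr_ge0 // ltW.
have := IH q N u' u'0 ss sN; rewrite rowhookS //.
rewrite [X in _ = _ * (_ * X)](eq_bigr (fun k =>
   hookpair alpha (alpha * (m%:R - (nth 0%N s k)%:R) + k.+1%:R + u) /
   hookpair alpha (alpha * (m%:R - (nth 0%N s k)%:R) + k.+1%:R + 1 + u))); last first.
  by move=> k _; congr (hookpair _ _ / hookpair _ _);
    rewrite /u' natrB // -natr1; ring.
move=> E.
have hu' : hookpair alpha u' != 0 by rewrite gt_eqF // hookpair_gt0.
rewrite (_ : u + alpha + 1 + _ = u' + alpha); last by rewrite /u'; ring.
rewrite mulrCA mulrA hookpair_row_telescope iota0S big_cons big_map /=.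
rewrite (_ : alpha * (m - q)%:R + u = alpha * (m%:R - q%:R) + 0 + u); last first.
  by rewrite natrB // addr0.
rewrite addr0 (_ : alpha * (m%:R - q%:R) + 1 + u = u'); last first.
  by rewrite /u' natrB //; ring.
apply: (mulfI hu').
rewrite (_ : hookpair alpha u' * (_ * rowhook alpha q s (u' + alpha)) =
  (\prod_(d <- iota 0 (m - q)) hookpair alpha (alpha * d%:R + u)) *
  hookpair alpha (alpha * (m%:R - q%:R) + u) *
  (hookpair alpha u' * rowhook alpha q s (u' + alpha))); last by ring.
rewrite E.
have -> : alpha * q%:R + N%:R + u' = alpha * m%:R + N.+1%:R + u.
  by rewrite /u' natrB // -natr1; ring.
by field.
Qed.

(** The function of a difference of contents through which both hook ratios and
transition weights are expressed; it is [hookpair] shifted by one. *)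
Definition cornerfun (R : realFieldType) (alpha u : R) : R := u * (u + alpha - 1).

Lemma cornerfun1 (R : realFieldType) (alpha u : R) :
  cornerfun alpha (u + 1) = hookpair alpha u.
Proof. by rewrite /cornerfun /hookpair; ring. Qed.

Lemma cornerfunN (R : realFieldType) (alpha u : R) :
  cornerfun alpha (- u) = hookpair alpha (u - alpha).
Proof. by rewrite /cornerfun /hookpair; ring. Qed.

(** Evaluates the leg of the box above the one that is added to row r. *)
Lemma count_longer_rows (s : seq nat) r : sorted geq s -> (r < size s)%N ->
  addable s r -> count (fun p => nth 0%N s r < p)%N s = r.
Proof.
elim: s r => // m s IH [|r] /sorted_geq_cons[sm ss] /= rs adr.
  by rewrite ltnn /= -[RHS](count_pred0 s); apply: eq_in_count => p /(allP sm) /=; lia.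
have rm : (nth 0 s r < m)%N.
  case: r rs adr => [|r] rs /=; rewrite /addable //= => rr.
  by apply: (leq_trans rr); apply: (allP sm); rewrite mem_nth // ltnW.
rewrite rm add1n IH //.
by case: r rs adr {rm} => [|r] rs; rewrite /addable.
Qed.

Lemma count_incr_nth (P : pred nat) (s : seq nat) r : (r < size s)%N ->
  (count P (incr_nth s r) + P (nth 0%N s r) = count P s + P (nth 0%N s r).+1)%N.
Proof. by elim: s r => // m s IH [|r] /= rs; [lia|have := IH r rs; lia]. Qed.

(** Adding a box to a lower row r changes one leg of the row m, that of the box
above the new one. *)
Lemma rowhook_incr (R : realFieldType) (alpha : R) m s r : 0 < alpha ->
  sorted geq (m :: s) -> (r < size s)%N -> addable (m :: s) r.+1 ->
  rowhook alpha m (incr_nth s r) 0 = rowhook alpha m s 0 *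
   (cornerfun alpha (xrow alpha (m :: s) r.+1 - alpha * m%:R) /
    cornerfun alpha (xrow alpha (m :: s) r.+1 - alpha * m%:R + 1)).
Proof.
move=> a0 ms rs adr; have [sm ss] := sorted_geq_cons ms.
have adr' : addable s r by case: r rs adr => [|r] rs; rewrite /addable.
have cr := count_longer_rows ss rs adr'.
set q := nth 0%N s r in cr *.
have qm : (q < m)%N.
  case: r rs adr @q {cr adr'} => [|r] rs //; rewrite {1}/addable /= => rr.
  by apply: (leq_trans rr); apply: (allP sm); rewrite mem_nth // ltnW.
(* The box above the new one lies in column q, so its arm is m - 1 - q. *)
have d0in : (m - q.+1)%N \in iota 0 m by rewrite mem_iota /=; lia.
rewrite /rowhook (bigD1_seq _ d0in (iota_uniq _ _)) /=.
rewrite [in RHS](bigD1_seq _ d0in (iota_uniq _ _)) /=.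
have cE d : (count (fun p => m <= p + d) (incr_nth s r) + (m <= q + d)
   = count (fun p => m <= p + d) s + (m <= q.+1 + d))%N := count_incr_nth _ rs.
have -> : count (fun p => m <= p + (m - q.+1))%N s = r.
  by rewrite -[RHS]cr; apply: eq_count => p; lia.
have -> : count (fun p => m <= p + (m - q.+1))%N (incr_nth s r) = r.+1.
  have := cE (m - q.+1)%N.
  rewrite (_ : count _ s = r); last by rewrite -[RHS]cr; apply: eq_count => p; lia.
  have -> : (m <= q + (m - q.+1))%N = false by lia.
  have -> : (m <= q.+1 + (m - q.+1))%N by lia.
  by rewrite addn0 addn1.
rewrite (eq_bigr (fun d => hookpair alpha
    (alpha * d%:R + (count (fun p => m <= p + d)%N s)%:R + 0))); last first.
  move=> d dd; congr hookpair; congr (_ + _%:R + _).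
  by have := cE d; case: (leqP m (q + d)) => ?; case: (leqP m (q.+1 + d)) => ?; lia.
rewrite /xrow /= -/q natrB //.
rewrite (_ : _ - _ - _ + 1 = - (alpha * (m%:R - q%:R) + r%:R)); last by rewrite -natr1; ring.
rewrite (_ : _ - _ - _ = - (alpha * (m%:R - q%:R) + r.+1%:R)); last by ring.
rewrite !cornerfunN.
rewrite (_ : alpha * (m%:R - q%:R) + r.+1%:R - alpha = alpha * (m%:R - q.+1%:R) + r.+1%:R + 0); last first.
  by rewrite -!natr1; ring.
rewrite (_ : alpha * (m%:R - q%:R) + r%:R - alpha = alpha * (m%:R - q.+1%:R) + r%:R + 0); last first.
  by rewrite -!natr1; ring.
have : hookpair alpha (alpha * (m%:R - q.+1%:R) + r%:R + 0) != 0.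
  by rewrite gt_eqF // hookpair_gt0 // !addr_ge0 // mulr_ge0 ?(ltW a0) // subr_ge0 ler_nat.
by move=> ?; field.
Qed.

Lemma xrow_cons (R : realFieldType) (alpha : R) m s k :
  xrow alpha (m :: s) k.+1 = xrow alpha s k - 1.
Proof. by rewrite /xrow /= -natr1; ring. Qed.

(** The hooks that change when a box is added to row r lie in its column, one in each
row above ([rowhook_incr]), and in its own row ([rowhook_ratio]). In terms of
contents both kinds of rows contribute the same factor. *)
Lemma hook_incr (R : realFieldType) (alpha : R) s N r : 0 < alpha ->
  sorted geq s -> size s = N -> (r < N)%N -> addable s r ->
  let x := xrow alpha s in
  hook alpha (incr_nth s r) = hook alpha s * (cornerfun alpha (x r - x N) *
    \prod_(k <- iota 0 N | k != r) (cornerfun alpha (x r - x k) / cornerfun alpha (x r - x k + 1))).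
Proof.
move=> a0 + <-{N}.
elim: s r => // m s IH [|r] ms rN adr x; have [sm ss] := sorted_geq_cons ms.
  rewrite iota0S big_cons big_map /= (rowhook_ratio a0 (lexx 0) ms (leqnn _)).
  rewrite mulrAC; congr (_ * (_ * _)).
    by rewrite -cornerfun1 /x /xrow /= nth_default // -natr1; congr cornerfun; ring.
  by apply: eq_bigr => k _; rewrite -!cornerfun1 /x /xrow /= -natr1;
    congr (cornerfun _ _ / cornerfun _ _); ring.
have adr' : addable s r by case: r rN adr => [|r] rN; rewrite /addable.
rewrite iota0S big_cons big_map /= (rowhook_incr a0 ms) // IH //.
rewrite {}/x xrow_cons (_ : xrow alpha (m :: s) 0 = alpha * m%:R); last first.
  by rewrite /xrow /= subr0.
have xB k : xrow alpha s r - 1 - (xrow alpha s k - 1) = xrow alpha s r - xrow alpha s k by ring.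
rewrite xrow_cons xB.
pose F k := cornerfun alpha (xrow alpha s r - xrow alpha s k) /
   cornerfun alpha (xrow alpha s r - xrow alpha s k + 1).
rewrite -/(size s) [in RHS](eq_big (fun k => k != r) F) //; last first.
  by move=> k _; rewrite xrow_cons xB.
by rewrite /F; ring.
Qed.

(** * Transition weights and their moments *)

(** Kerov's transition probability from s to s with a box added to row r: the
residue at x_r of prod_(k < N) (z - x_k + 1) / prod_(k <= N) (z - x_k). All N rows
are used, empty ones included: the pole of a row is cancelled by the zero of a row of
equal length just above it, so the formula vanishes at rows which are not addable. *)
Definition upw (R : realFieldType) (alpha : R) (N : nat) (s : seq nat) (r : nat) : R :=
  let x := xrow alpha s in
  \prod_(k <- iota 0 N) (x r - x k + 1) / \prod_(k <- iota 0 N.+1 | k != r) (x r - x k).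

(** The opposite of the residue at x_r - 1 of the reciprocal of the rational
function defining [upw]. Divided by alpha * sumn s it is the probability that the
removed box is the last box of row r. *)
Definition downw (R : realFieldType) (alpha : R) (N : nat) (s : seq nat) (r : nat) : R :=
  let x := xrow alpha s in
  - (\prod_(k <- iota 0 N.+1) (x r - 1 - x k) / \prod_(k <- iota 0 N | k != r) (x r - x k)).

Definition removable (s : seq nat) (r : nat) : bool :=
  (nth 0%N s r.+1 < nth 0%N s r)%N.

Definition contentsum (R : realFieldType) (alpha : R) (s : seq nat) : R :=
  \sum_(i <- iota 0 (size s)) \sum_(j <- iota 0 (nth 0%N s i)) (alpha * j%:R - i%:R).

Lemma nth_geq (s : seq nat) i j : sorted geq s -> (i <= j)%N ->
  (nth 0 s j <= nth 0 s i)%N.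
Proof.
move=> ss ij; have [js|sj] := ltnP j (size s); last by rewrite (nth_default 0%N sj).
have geq_tr : transitive geq by move=> a b c ab bc; exact: leq_trans bc ab.
apply: (sorted_leq_nth geq_tr leqnn 0%N ss) => //; rewrite inE //.
exact: leq_ltn_trans js.
Qed.

Lemma xrow_lt (R : realFieldType) (alpha : R) s i j : 0 < alpha -> sorted geq s ->
  (i < j)%N -> xrow alpha s j < xrow alpha s i.
Proof.
move=> a0 ss ij; rewrite /xrow.
have : (nth 0%N s j)%:R <= (nth 0%N s i)%:R :> R by rewrite ler_nat nth_geq // ltnW.
have : i%:R < j%:R :> R by rewrite ltr_nat.
by move=> ? ?; nra.
Qed.

Lemma xrow_inj (R : realFieldType) (alpha : R) s : 0 < alpha -> sorted geq s ->
  injective (xrow alpha s).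
Proof.
move=> a0 ss i j; case: (ltngtP i j) => // ij E.
- by have := xrow_lt a0 ss ij; rewrite E ltxx.
- by have := xrow_lt a0 ss ij; rewrite E ltxx.
Qed.

Lemma residue_sum_upw (R : realFieldType) (alpha : R) N s k : 0 < alpha -> sorted geq s ->
  residue_sum (map (xrow alpha s) (iota 0 N.+1)) (map (fun i => xrow alpha s i - 1) (iota 0 N)) k
  = \sum_(r <- iota 0 N.+1) xrow alpha s r ^+ k * upw alpha N s r.
Proof.
move=> a0 ss; rewrite /residue_sum big_map; apply: eq_bigr => r _.
rewrite /upw -mulrA !big_map; congr (_ * (_ / _)).
  by apply: eq_bigr => i _; rewrite opprB addrA addrAC.
by apply: eq_bigl => i; rewrite (inj_eq (xrow_inj a0 ss)).
Qed.

Lemma residue_sum_downw (R : realFieldType) (alpha : R) N s k : 0 < alpha -> sorted geq s ->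
  residue_sum (map (fun i => xrow alpha s i - 1) (iota 0 N)) (map (xrow alpha s) (iota 0 N.+1)) k
  = - \sum_(r <- iota 0 N) (xrow alpha s r - 1) ^+ k * downw alpha N s r.
Proof.
move=> a0 ss; rewrite /residue_sum big_map -sumrN; apply: eq_bigr => r _.
rewrite /downw mulrN opprK -mulrA !big_map; congr (_ * (_ / _)).
apply: eq_big => [i|i _]; first by rewrite (inj_eq (addIr _)) (inj_eq (xrow_inj a0 ss)).
by rewrite opprB addrA subrK.
Qed.

Lemma powsumN (R : realFieldType) (X Y : seq R) k : powsum k Y X = - powsum k X Y.
Proof. by rewrite /powsum opprB. Qed.

Lemma row_content (R : realFieldType) (alpha : R) m i :
  \sum_(j <- iota 0 m) (alpha * j%:R - i%:R) = alpha * (m%:R * (m%:R - 1) / 2%:R) - i%:R * m%:R.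
Proof.
elim: m => [|m IH]; first by rewrite big_nil; ring.
by rewrite iota0Sr big_rcons /= IH -natr1; field.
Qed.

Lemma powsum_rows (R : realFieldType) (alpha : R) s k :
  let x := xrow alpha s in
  powsum k (map x (iota 0 (size s).+1)) (map (fun i => x i - 1) (iota 0 (size s)))
  = \sum_(i <- iota 0 (size s)) (x i ^+ k - (x i - 1) ^+ k) + (- (size s)%:R) ^+ k.
Proof.
rewrite /powsum iota0Sr !big_map big_rcons /= sumrB.
rewrite /xrow [nth 0%N s (size s)]nth_default // mulr0 sub0r.
by rewrite addrAC addrC.
Qed.

Lemma powsum_row1 (R : realFieldType) (alpha : R) s :
  let x := xrow alpha s in
  powsum 1 (map x (iota 0 (size s).+1)) (map (fun i => x i - 1) (iota 0 (size s))) = 0.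
Proof.
move=> x; rewrite powsum_rows; elim: (size s) => [|N IH]; first by rewrite big_nil oppr0 addr0.
rewrite iota0Sr big_rcons /= -[RHS]IH -natr1; ring.
Qed.

Lemma sumn_iota (R : realFieldType) (s : seq nat) :
  (sumn s)%:R = \sum_(i <- iota 0 (size s)) (nth 0%N s i)%:R :> R.
Proof.
elim: s => [|m s IH]; first by rewrite big_nil.
by rewrite /= natrD IH -[iota 1 _]/(behead (iota 0 (size s).+1)) iota0S big_cons big_map.
Qed.

Lemma powsum_row2 (R : realFieldType) (alpha : R) s :
  let x := xrow alpha s in
  powsum 2 (map x (iota 0 (size s).+1)) (map (fun i => x i - 1) (iota 0 (size s)))
  = 2%:R * alpha * (sumn s)%:R.
Proof.
move=> x; rewrite powsum_rows sumn_iota /x /xrow.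
elim: (size s) => [|N IH]; first by rewrite !big_nil /=; ring.
rewrite !iota0Sr !big_rcons /= mulrDr -IH -natr1; ring.
Qed.

(** The third power sum of the transition measure sees the content sum; this is what
makes the mean content of a removed box linear in the statistic ([downw_mean]). *)
Lemma powsum_row3 (R : realFieldType) (alpha : R) s :
  let x := xrow alpha s in
  powsum 3 (map x (iota 0 (size s).+1)) (map (fun i => x i - 1) (iota 0 (size s)))
  = 6%:R * alpha * contentsum alpha s + 3%:R * alpha * (alpha - 1) * (sumn s)%:R.
Proof.
move=> x; rewrite powsum_rows sumn_iota /x /xrow /contentsum.
elim: (size s) => [|N IH]; first by rewrite !big_nil /=; ring.
rewrite !iota0Sr !big_rcons /= row_content.
move/eqP: IH; rewrite -subr_eq0 => /eqP IH; apply/eqP; rewrite -subr_eq0 -[X in _ == X]IH.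
by apply/eqP; rewrite -natr1; field.
Qed.

(** Keeps the hook ratio of [detailed_balance] away from 0 / 0: above an addable
row, a difference of contents is not only nonzero but at most - 1 - alpha. *)
Lemma xrow_addable (R : realFieldType) (alpha : R) s k r : 0 < alpha -> sorted geq s ->
  addable s r -> (k < r)%N -> xrow alpha s r - xrow alpha s k + 1 < 0 /\
  xrow alpha s r + alpha - xrow alpha s k < 0.
Proof.
move=> a0 ss adr kr.
have sk : (nth 0%N s r < nth 0%N s k)%N.
  move: adr; rewrite /addable gtn_eqF /=; last by lia.
  by move=> h; apply: (leq_trans h); apply: nth_geq => //; lia.
have h1 : alpha * (nth 0%N s r)%:R + alpha <= alpha * (nth 0%N s k)%:R.
  by rewrite -[X in _ + X <= _]mulr1 -mulrDr ler_wpM2l ?(ltW a0) // natr1 ler_nat.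
have h2 : k%:R + 1 <= r%:R :> R by rewrite natr1 ler_nat.
by rewrite /xrow; split; lra.
Qed.

Section Moments.
Context {R : realFieldType} (alpha : R) (s : seq nat).
Hypotheses (a0 : 0 < alpha) (ss : sorted geq s).
Local Notation N := (size s).
Local Notation x := (xrow alpha s).

Let uX : uniq (map x (iota 0 N.+1)).
Proof. by rewrite (map_inj_uniq (xrow_inj a0 ss)) iota_uniq. Qed.

Let uY : uniq (map (fun i => x i - 1) (iota 0 N)).
Proof.
by rewrite map_inj_uniq ?iota_uniq // => i j /addIr /(xrow_inj a0 ss).
Qed.

Lemma upw_moment e : (e <= 2)%N ->
  \sum_(r <- iota 0 N.+1) x r ^+ e * upw alpha N s r =
  match e with 0%N => 1 | 1%N => 0 | _ => alpha * (sumn s)%:R end.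
Proof.
move=> e2; rewrite -residue_sum_upw // (residue_sum_hsym (e := e) uX).
- by case: e e2 => [|[|[|//]]] _; rewrite /hsym ?powsum_row2 ?powsum_row1 //; field.
- exact: leq_trans e2 _.
- by rewrite !size_map !size_iota; lia.
Qed.

Lemma downw_mass : \sum_(r <- iota 0 N) downw alpha N s r = alpha * (sumn s)%:R.
Proof.
have := residue_sum_downw N 0 a0 ss.
under [X in _ = - X]eq_bigr do rewrite expr0 mul1r.
rewrite (residue_sum_hsym (e := 2) uY) //; last by rewrite !size_map !size_iota; lia.
rewrite /hsym [powsum 1 _ _]powsumN [powsum 2 _ _]powsumN powsum_row1 powsum_row2 => E.
by rewrite -[LHS]opprK -E; field.
Qed.

(** The removed box of row r has content x_r - alpha, so this says that a box
removed at random has mean content 2 * contentsum / sumn s. *)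
Lemma downw_mean : \sum_(r <- iota 0 N) (x r - alpha) * downw alpha N s r
  = 2%:R * alpha * contentsum alpha s.
Proof.
have := residue_sum_downw N 1 a0 ss.
under [X in _ = - X]eq_bigr do rewrite expr1.
rewrite (residue_sum_hsym (e := 3) uY) //; last by rewrite !size_map !size_iota; lia.
rewrite /hsym [powsum 1 _ _]powsumN [powsum 3 _ _]powsumN powsum_row1 powsum_row3 => E.
rewrite (eq_bigr (fun r => (x r - 1) * downw alpha N s r - (alpha - 1) * downw alpha N s r)); last first.
  by move=> r _; ring.
rewrite sumrB -mulr_sumr downw_mass.
by rewrite -[X in X - _]opprK -E; field.
Qed.

End Moments.

(** Inductive step of [upw_le] at a row of the same length as row r. *)
Lemma equal_row_step (R : realFieldType) (a C D : R) : 0 <= a -> 0 < D -> C <= D ->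
  C * (1 + D^-1) * (a + D) <= (C + 1) * (a + (D + 1)).
Proof.
move=> a0 D0 CD.
have DI : C * D^-1 * D = C by rewrite mulfVK ?gt_eqF.
have CI : C * D^-1 * a <= a by rewrite ler_piMl // ler_pdivrMr // mul1r.
rewrite (mulrDr C) mulr1; move: (C * D^-1) DI CI => W DI CI; lra.
Qed.

Section Weights.
Context {R : realFieldType} (alpha : R) (s : seq nat) (r : nat).
Hypotheses (a0 : 0 < alpha) (ss : sorted geq s) (rN : (r < size s)%N).
Local Notation N := (size s).
Local Notation x := (xrow alpha s).

Let rin : r \in iota 0 N. Proof. by rewrite mem_iota. Qed.

Lemma upwE : upw alpha N s r =
  (\prod_(k <- iota 0 N | k != r) ((x r - x k + 1) / (x r - x k))) / (x r - x N).
Proof.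
rewrite /upw iota0Sr big_rcons /= ifT; last by rewrite gtn_eqF.
rewrite (bigD1_seq r rin (iota_uniq _ _)) /= subrr add0r mul1r.
by rewrite invfM prodf_div mulrA mulrAC.
Qed.

Lemma upw_unaddable : ~~ addable s r -> upw alpha N s r = 0.
Proof.
rewrite /addable negb_or -lt0n -leqNgt => /andP[r0 sr].
have rin' : r.-1 \in iota 0 N by rewrite mem_iota; lia.
rewrite /upw (bigD1_seq _ rin' (iota_uniq _ _)) /=.
have -> : x r - x r.-1 + 1 = 0.
  rewrite /xrow (_ : nth 0%N s r.-1 = nth 0%N s r); last first.
    by apply/eqP; rewrite eqn_leq sr nth_geq // leq_pred.
  by rewrite -[in r%:R](prednK r0) -natr1; ring.
by rewrite !mul0r.
Qed.

Lemma downw_unremovable : ~~ removable s r -> downw alpha N s r = 0.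
Proof.
rewrite /removable -leqNgt => sr.
have rin' : r.+1 \in iota 0 N.+1 by rewrite mem_iota; lia.
rewrite /downw (bigD1_seq _ rin' (iota_uniq _ _)) /=.
have -> : x r - 1 - x r.+1 = 0.
  rewrite /xrow (_ : nth 0%N s r.+1 = nth 0%N s r); last first.
    by apply/eqP; rewrite eqn_leq sr nth_geq.
  by rewrite -natr1; ring.
by rewrite !mul0r oppr0.
Qed.

Lemma xrow_before k : (k < r)%N -> x r - x k <= -1.
Proof.
move=> kr; rewrite /xrow.
have srk : (nth 0%N s r)%:R <= (nth 0%N s k)%:R :> R by rewrite ler_nat nth_geq // ltnW.
have kr' : k%:R + 1 <= r%:R :> R by rewrite natr1 ler_nat.
by have := ler_wpM2l (ltW a0) srk; lra.
Qed.

Lemma upw_factor_ge0 k : k != r -> 0 <= (x r - x k + 1) / (x r - x k).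
Proof.
case: ltngtP => // kr _.
  by have := xrow_before kr => ?; rewrite mulr_le0 // ?invr_le0; lra.
by have := xrow_lt a0 ss kr => ?; rewrite divr_ge0 //; lra.
Qed.

Lemma upw_factor_le1 k : (k < r)%N -> (x r - x k + 1) / (x r - x k) <= 1.
Proof. by move=> /xrow_before ?; rewrite ler_ndivrMr; lra. Qed.

Lemma upw_ge0 : 0 <= upw alpha N s r.
Proof.
rewrite upwE divr_ge0 //; last by rewrite subr_ge0 ltW // xrow_lt.
by apply: prodr_ge0 => k; exact: upw_factor_ge0.
Qed.

(** The rows above row r contribute factors at most 1. Among the rows below, the
d-th one contributes 1 + 1 / d if it has the length of row r, and at most
1 + 1 / (alpha + d) otherwise. So the product over the rows down to row r + d is at
most (alpha + d + 1) / alpha times the number of rows of that length among them. *)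
Lemma upw_le : (0 < nth 0%N s r)%N ->
  upw alpha N s r <= (count_mem (nth 0%N s r) s)%:R / alpha.
Proof.
move=> j0; set j := nth 0%N s r in j0 *.
pose c d := count (fun k => nth 0%N s k == j) (iota r d).
pose f k := (x r - x k + 1) / (x r - x k).
have c_le d : (c d <= d)%N by rewrite /c -[leqRHS](size_iota r d) count_size.
(* c d.+1 counts the rows of length j from row r down to row r + d. *)
have fprod d : \prod_(k <- iota 0 (r + d.+1) | k != r) f k
    <= (c d.+1)%:R * ((alpha + d.+1%:R) / alpha).
  elim: d => [|d IH].
    rewrite addn1 iota0Sr big_rcons /= eqxx /= /c /= eqxx addn0 mul1r.
    apply: (@le_trans _ _ 1).
      rewrite mulr1 big_seq_cond; apply: prodr_ile1 => k /andP[].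
      rewrite mem_iota => /= kr kNr.
      by rewrite upw_factor_ge0 // upw_factor_le1.
    by rewrite ler_pdivlMr // mul1r; lra.
  rewrite addnS iota0Sr big_rcons /= ifT; last by rewrite gtn_eqF //; lia.
  have cS : c d.+2 = (c d.+1 + (nth 0%N s (r + d.+1) == j))%N.
    by rewrite /c -[d.+2]addn1 iotaD count_cat /= addn0.
  have f0 : 0 <= f (r + d.+1)%N by apply: upw_factor_ge0; rewrite gtn_eqF //; lia.
  have P0 : 0 <= \prod_(k <- iota 0 (r + d.+1) | k != r) f k.
    by apply: prodr_ge0 => k; exact: upw_factor_ge0.
  apply: (@le_trans _ _ (f (r + d.+1)%N * ((c d.+1)%:R * ((alpha + d.+1%:R) / alpha)))).
    by rewrite mulrC; exact: ler_wpM2l.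
  have jK : (nth 0%N s (r + d.+1) <= j)%N by apply: nth_geq => //; lia.
  have d1 : 0 < d.+1%:R :> R by rewrite ltr0n.
  have c0 : 0 <= (c d.+1)%:R :> R by [].
  have cd : (c d.+1)%:R <= d.+1%:R :> R by rewrite ler_nat.
  have ai : 0 < alpha^-1 by rewrite invr_gt0.
  rewrite [f _ * _]mulrCA [in leLHS]mulrA [in leRHS]mulrA mulrA ler_pM2r // cS natrD.
  have -> : f (r + d.+1)%N = 1 + (x r - x (r + d.+1)%N)^-1.
    rewrite /f mulrDl divff ?mul1r // subr_eq0.
    by rewrite (inj_eq (xrow_inj a0 ss)) ltn_eqF //; lia.
  rewrite /xrow -/j natrD -[d.+2%:R]natr1.
  case: eqP => [->|/eqP jNK].
    rewrite (_ : alpha * j%:R - r%:R - _ = d.+1%:R); last by ring.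
    by apply: equal_row_step => //; exact: ltW.
  have jK' : (nth 0%N s (r + d.+1)).+1%:R <= j%:R :> R.
    by rewrite ler_nat ltn_neqAle jNK.
  set E := alpha * j%:R - r%:R - _.
  have ED : alpha + d.+1%:R <= E.
    by move: (ler_wpM2l (ltW a0) jK'); rewrite /E -natr1; lra.
  have E0 : 0 < E by apply: lt_le_trans ED; exact: addr_gt0.
  have : (alpha + d.+1%:R) * E^-1 <= 1 by rewrite ler_pdivrMr // mul1r.
  by move/(ler_wpM2l c0); rewrite /= addr0 mulr1; move: E^-1 => I; lra.
rewrite upwE ler_pdivrMr; last by rewrite subr_gt0 xrow_lt.
have NrE : N = (r + (N - r).-1.+1)%N by lia.
apply: le_trans (_ : _ <= (c (N - r).-1.+1)%:R * ((alpha + (N - r).-1.+1%:R) / alpha)) _.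
  by have := fprod (N - r).-1; rewrite -NrE.
rewrite prednK ?subn_gt0 // mulrA [leRHS]mulrAC ler_pM2r ?invr_gt0 //.
have cj : (c (N - r) <= count_mem j s)%N.
  rewrite /c -(count_map (nth 0%N s) (pred1 j)) map_nth_iota; last lia.
  rewrite take_oversize ?size_drop // -[X in (_ <= count _ X)%N](cat_take_drop r s).
  by rewrite count_cat leq_addl.
apply: ler_pM => //; first by rewrite addr_ge0 // ltW.
  by rewrite ler_nat.
rewrite /xrow [nth 0%N s N]nth_default // -/j natrB ?(ltnW rN) //.
have : 1 <= j%:R :> R by rewrite ler1n.
by move/(ler_wpM2l (ltW a0)); lra.
Qed.

Lemma xrow_incr k : xrow alpha (incr_nth s r) k = x k + alpha * (k == r)%:R.
Proof. by rewrite /xrow nth_incr_nth natrD eq_sym; ring. Qed.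

(** Up to the normalisations of [jackmass] this equates the probability of growing
from s into its successor with that of shrinking back. *)
Lemma detailed_balance : addable s r ->
  hook alpha (incr_nth s r) * upw alpha N s r = hook alpha s * downw alpha N (incr_nth s r) r.
Proof.
move=> adr; rewrite (hook_incr a0 ss erefl rN adr) upwE.
rewrite /downw iota0Sr big_rcons /= (bigD1_seq r rin (iota_uniq _ _)) /=.
rewrite !xrow_incr eqxx mulr1 [N == r]gtn_eqF // mulr0 addr0.
rewrite [X in _ * - X](_ : _ = - ((x r + alpha - 1 - x N) *
   \prod_(k <- iota 0 N | k != r) ((x r + alpha - 1 - x k) / (x r + alpha - x k)))); last first.
  rewrite prodf_div [in RHS](eq_bigr (fun k => x r + alpha - 1 - xrow alpha (incr_nth s r) k)); last first.
    by move=> k kr; rewrite xrow_incr (negbTE kr) mulr0 addr0.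
  rewrite [X in _ / X](eq_bigr (fun k => x r + alpha - x k)); last first.
    by move=> k kr; rewrite xrow_incr (negbTE kr) mulr0 addr0.
  by ring.
rewrite opprK -!mulrA; congr (_ * _).
have xN : x r - x N != 0 by rewrite subr_eq0 gt_eqF // xrow_lt.
rewrite [X in _ * (_ * X)]mulrA -big_split /= (eq_bigr (fun k => (x r + alpha - 1 - x k) / (x r + alpha - x k))).
  by field.
move=> k kr; rewrite /cornerfun.
have u0 : x r - x k != 0 by rewrite subr_eq0 (inj_eq (xrow_inj a0 ss)) eq_sym.
have [u1 ua] : x r - x k + 1 != 0 /\ x r + alpha - x k != 0.
  case: (ltngtP k r) kr => // kr _.
    by have [? ?] := xrow_addable a0 ss adr kr; split; rewrite lt_eqF.
  have kr' : 0 < x r - x k by rewrite subr_gt0 xrow_lt.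
  by split; rewrite gt_eqF // ?[_ + alpha - _]addrAC addr_gt0.
rewrite (_ : x r - x k + 1 + alpha - 1 = x r + alpha - x k); last by ring.
by field; rewrite u0 u1 ua.
Qed.
End Weights.

Lemma upw_last (R : realFieldType) (alpha : R) (s : seq nat) :
  (0 < size s)%N -> nth 0%N s (size s).-1 = 0%N -> upw alpha (size s) s (size s) = 0.
Proof.
move=> s0 sl.
have rin' : (size s).-1 \in iota 0 (size s) by rewrite mem_iota; lia.
rewrite /upw (bigD1_seq _ rin' (iota_uniq _ _)) /=.
have -> : xrow alpha s (size s) - xrow alpha s (size s).-1 + 1 = 0.
  rewrite /xrow sl [nth 0%N s (size s)]nth_default // -[in X in _ - X - _](prednK s0) -natr1.
  by ring.
by rewrite !mul0r.
Qed.

(** * The Jack growth process *)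

(** Partitions of k are padded with zeros to N rows, so that adding a box is
[incr_nth] on lists of a fixed length, whatever the number of nonzero rows. *)
Definition padded (N k : nat) : seq (seq nat) :=
  [seq s <- [seq map val (tval t) | t <- enum {: N.-tuple 'I_N.+1}]
     | sorted geq s && (sumn s == k)].

Definition jackmass (R : realFieldType) (alpha : R) (s : seq nat) : R :=
  alpha ^+ (sumn s) * (sumn s)`!%:R / hook alpha s.

Definition expect (R : realFieldType) (alpha : R) (N k : nat) (F : seq nat -> R) : R :=
  \sum_(s <- padded N k) jackmass alpha s * F s.

Lemma leq_nth_sumn (s : seq nat) i : (nth 0 s i <= sumn s)%N.
Proof.
elim: s i => [|m s IH] [|i] //=; first exact: leq_addr.
exact: leq_trans (IH i) (leq_addl _ _).
Qed.

Lemma sumn_incr_nth (s : seq nat) i : sumn (incr_nth s i) = (sumn s).+1.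
Proof.
elim: s i => [|m s IH] [|i] //=; last by rewrite IH addnS.
by rewrite sumn_ncons mul0n.
Qed.

Lemma mem_padded N k s : (k <= N)%N ->
  (s \in padded N k) = [&& size s == N, sorted geq s & sumn s == k].
Proof.
move=> kN; rewrite mem_filter andbC; apply/andP/and3P => [[/mapP[t _ ->] /andP[-> ->]]|[/eqP sN ss /eqP sk]].
  by rewrite size_map size_tuple eqxx.
rewrite ss sk eqxx; split=> //; apply/mapP.
have sm : all (fun m => m <= N)%N s.
  by apply/(all_nthP 0%N) => i _; apply: leq_trans kN; rewrite -sk leq_nth_sumn.
have tN : size [seq inord m : 'I_N.+1 | m <- s] == N by rewrite size_map sN.
exists (Tuple tN); first by rewrite mem_enum.
rewrite /= -map_comp -[LHS]map_id; apply/eq_in_map => m /(allP sm) mN /=.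
by rewrite inordK.
Qed.

Lemma padded_uniq N k : uniq (padded N k).
Proof.
apply: filter_uniq; rewrite map_inj_uniq ?enum_uniq //.
move=> t t' /(inj_map val_inj) tt'; exact: val_inj.
Qed.

Lemma sorted_geqP (s : seq nat) :
  reflect (forall i, (nth 0 s i.+1 <= nth 0 s i)%N) (sorted geq s).
Proof.
apply: (iffP (sortedP 0%N)) => h i; last by move=> _; exact: h.
have [/h //|si] := ltnP i.+1 (size s).
by rewrite nth_default.
Qed.

(** The inverse removes the last box of row r: [addable] and [removable] are the
conditions under which the rows stay sorted. *)
Lemma perm_padded_incr N k r : (k < N)%N -> (r < N)%N ->
  perm_eq [seq s <- padded N k.+1 | removable s r]
    [seq incr_nth t r | t <- [seq t <- padded N k | addable t r]].
Proof.
move=> kN rN; apply: uniq_perm.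
- exact/filter_uniq/padded_uniq.
- rewrite map_inj_in_uniq; first exact/filter_uniq/padded_uniq.
  move=> t t'; rewrite mem_filter => /andP[_]; rewrite mem_padded ?(ltnW kN) //.
  move=> /and3P[/eqP st _ _].
  rewrite mem_filter => /andP[_]; rewrite mem_padded ?(ltnW kN) // => /and3P[/eqP st' _ _] E.
  apply: (@eq_from_nth _ 0%N); first by rewrite st st'.
  move=> i _; have := congr1 (fun u => nth 0%N u i) E.
  by rewrite !nth_incr_nth => /addnI.
move=> s; rewrite mem_filter mem_padded //; apply/idP/mapP.
  case/and4P=> rs /eqP sN /sorted_geqP ss /eqP sk.
  pose t := set_nth 0%N s r (nth 0%N s r).-1.
  have nt i : nth 0%N t i = (nth 0 s i - (i == r))%N.
    by rewrite nth_set_nth /=; case: eqP => [->|_]; rewrite ?subn0 ?subn1.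
  have st : size t = N by rewrite size_set_nth sN; apply/maxn_idPr.
  have E : s = incr_nth t r.
    apply: (@eq_from_nth _ 0%N); first by rewrite size_incr_nth st rN.
    move=> i _; rewrite nth_incr_nth nt eq_sym.
    by case: eqP => [->|_]; rewrite ?subn0 //; move: rs; rewrite /removable; lia.
  exists t => //; rewrite mem_filter mem_padded ?(ltnW kN) // st eqxx /=.
  have := sk; rewrite E sumn_incr_nth => -[->]; rewrite eqxx andbT.
  apply/andP; split.
    rewrite /addable; have [//|r0 /=] := posnP r; rewrite !nt eqxx.
    by have := ss r.-1; rewrite prednK //; move: rs; rewrite /removable; lia.
  apply/sorted_geqP => i; rewrite !nt; have := ss i; move: rs; rewrite /removable.
  by case: (eqVneq i r) => [->|]; lia.
case=> t; rewrite mem_filter mem_padded ?(ltnW kN) //.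
case/and4P=> adr /eqP st /sorted_geqP ss /eqP tk ->.
rewrite size_incr_nth st rN eqxx sumn_incr_nth tk eqxx andbT /=.
apply/andP; split.
  by rewrite /removable !nth_incr_nth; have := ss r; lia.
apply/sorted_geqP => i; rewrite !nth_incr_nth; have := ss i.
case: (eqVneq r i.+1) => [E|]; last by lia.
by move: adr; rewrite E /addable /=; lia.
Qed.

Section Growth.
Variables (R : realFieldType) (alpha : R) (N : nat).
Hypothesis a0 : 0 < alpha.
Local Notation E := (expect alpha N).

Lemma jackmass_gt0 s : 0 < jackmass alpha s.
Proof.
by rewrite /jackmass divr_gt0 ?hook_gt0 // mulr_gt0 ?exprn_gt0 // ltr0n fact_gt0.
Qed.

Lemma eq_expect k F G : (k <= N)%N ->
  (forall s, size s = N -> sorted geq s -> sumn s = k -> F s = G s) -> E k F = E k G.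
Proof.
move=> kN FG; apply: eq_big_seq => s; rewrite mem_padded // => /and3P[/eqP ? ? /eqP ?].
by rewrite FG.
Qed.

Lemma le_expect k F G : (k <= N)%N ->
  (forall s, size s = N -> sorted geq s -> sumn s = k -> F s <= G s) -> E k F <= E k G.
Proof.
move=> kN FG; rewrite /expect big_seq [leRHS]big_seq; apply: ler_sum => s.
rewrite mem_padded // => /and3P[/eqP ? ? /eqP ?].
by apply: ler_wpM2l; [exact/ltW/jackmass_gt0|exact: FG].
Qed.

Lemma expectD k F G : E k (fun s => F s + G s) = E k F + E k G.
Proof. by rewrite /expect -big_split; apply: eq_bigr => s _; rewrite mulrDr. Qed.

Lemma expectZ k c F : E k (fun s => c * F s) = c * E k F.
Proof. by rewrite /expect mulr_sumr; apply: eq_bigr => s _; rewrite mulrCA. Qed.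

(** A Jack diagram of size k that grows by one box has the same joint law with its
successor as a Jack diagram of size k + 1 that loses a box. *)
Lemma jack_grow_shrink k (F : seq nat -> nat -> R) : (k < N)%N ->
  E k (fun t => \sum_(r <- iota 0 N) upw alpha N t r * F (incr_nth t r) r)
  = (alpha * k.+1%:R)^-1 * E k.+1 (fun s => \sum_(r <- iota 0 N) downw alpha N s r * F s r).
Proof.
move=> kN; rewrite /expect.
under eq_bigr do rewrite mulr_sumr.
under [in RHS]eq_bigr do rewrite mulr_sumr.
rewrite exchange_big [in RHS]exchange_big /= mulr_sumr.
apply: eq_big_seq => r; rewrite mem_iota /= => rN.
rewrite -[RHS](_ : (alpha * k.+1%:R)^-1 * \sum_(s <- padded N k.+1 | removable s r)
   jackmass alpha s * (downw alpha N s r * F s r) = _); last first.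
  congr (_ * _); rewrite big_mkcond; apply: eq_big_seq => s.
  rewrite mem_padded // => /and3P[/eqP sN ss _]; case: ifP => // /negbT nr.
  by rewrite -sN downw_unremovable ?sN // mul0r mulr0.
rewrite -[RHS in _ = _ * RHS]big_filter (perm_big _ (perm_padded_incr kN rN)) big_map big_filter.
rewrite mulr_sumr [RHS]big_mkcond; apply: eq_big_seq => t.
rewrite mem_padded ?(ltnW kN) // => /and3P[/eqP tN ss /eqP tk]; case: ifP => [adr|/negbT nadr]; last first.
  by rewrite -tN upw_unaddable ?tN // mul0r mulr0.
rewrite /jackmass sumn_incr_nth tk.
have := detailed_balance a0 ss; rewrite tN => /(_ r rN adr) B.
have h0 : hook alpha t != 0 by rewrite gt_eqF ?hook_gt0.
have h1 : hook alpha (incr_nth t r) != 0 by rewrite gt_eqF ?hook_gt0.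
have U : upw alpha N t r = hook alpha t / hook alpha (incr_nth t r) * downw alpha N (incr_nth t r) r.
  by apply: (mulfI h1); rewrite B; field.
rewrite U factS natrM exprS.
have k0 : k.+1%:R != 0 :> R by rewrite pnatr_eq0.
have a00 : alpha != 0 by rewrite gt_eqF.
set K := k.+1%:R in k0 *; set H0 := hook _ _ in h0 *; set H1 := hook _ _ in h1 *.
set D := downw _ _ _ _; set G := F _ _; set f := k`!%:R; set A := alpha ^+ k; move: K H0 H1 D G f A k0 h0 h1.
by move=> *; field; do ?[apply/andP; split].
Qed.

Lemma expect_grow k (F : seq nat -> R) : (k < N)%N ->
  E k.+1 F = E k (fun t => \sum_(r <- iota 0 N) upw alpha N t r * F (incr_nth t r)).
Proof.
move=> kN; rewrite (jack_grow_shrink (fun s _ => F s)) // -expectZ.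
apply: eq_expect => // s sN ss sk.
rewrite -mulr_suml -[in iota 0 N]sN -sN (downw_mass a0 ss) sk mulrA mulVf ?mul1r //.
by rewrite mulf_neq0 ?pnatr_eq0 // gt_eqF.
Qed.

(** The content of the added box, given the larger diagram, has mean
2 / (k + 1) times the content sum: the linearity behind the zero-bias coupling. *)
Lemma expect_grow_content k (F : seq nat -> R) : (k < N)%N ->
  E k (fun t => \sum_(r <- iota 0 N) upw alpha N t r * (xrow alpha t r * F (incr_nth t r)))
  = 2%:R / k.+1%:R * E k.+1 (fun s => contentsum alpha s * F s).
Proof.
move=> kN; have k0 : k.+1%:R != 0 :> R by rewrite pnatr_eq0.
have a00 : alpha != 0 by rewrite gt_eqF.
transitivity (E k (fun t => \sum_(r <- iota 0 N) upw alpha N t r *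
   ((xrow alpha (incr_nth t r) r - alpha) * F (incr_nth t r)))).
  apply: eq_expect => [|t _ _ _]; first exact: ltnW.
  by apply: eq_bigr => r _; rewrite xrow_incr eqxx mulr1 addrK.
rewrite (jack_grow_shrink (fun s r => (xrow alpha s r - alpha) * F s)) // -!expectZ.
apply: eq_expect => // s sN ss sk.
rewrite (eq_bigr (fun r => (xrow alpha s r - alpha) * downw alpha N s r * F s)); last first.
  by move=> r _; ring.
rewrite -mulr_suml -[in iota 0 N]sN -sN (downw_mean a0 ss).
by set K := k.+1%:R in k0 *; move: K k0 => K k0; field; rewrite k0 a00.
Qed.

Lemma upw_last0 t : (sumn t < N)%N -> sorted geq t -> size t = N -> upw alpha N t N = 0.
Proof.
move=> tN st sN; rewrite -sN upw_last // sN; first by lia.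
apply/eqP; rewrite -leqn0 leqNgt; apply/negP => t0.
have : (N <= sumn t)%N; last by lia.
rewrite -[X in (X <= _)%N]sN.
have : all (leq 1) t.
  apply/(all_nthP 0%N) => i it; apply: (leq_trans t0); apply: nth_geq => //; lia.
by elim: (t) => //= m u IH /andP[m1 /IH]; lia.
Qed.

Lemma upw_moment_lt t e : (sumn t < N)%N -> sorted geq t -> size t = N -> (e <= 2)%N ->
  \sum_(r <- iota 0 N) upw alpha N t r * xrow alpha t r ^+ e =
  match e with 0%N => 1 | 1%N => 0 | _ => alpha * (sumn t)%:R end.
Proof.
move=> tN st sN e2; rewrite -(upw_moment a0 st e2) sN iota0Sr big_rcons /=.
rewrite upw_last0 // mulr0 addr0; apply: eq_bigr => r _; exact: mulrC.
Qed.

Lemma expect1 k : (k <= N)%N -> E k (fun _ => 1) = 1.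
Proof.
elim: k => [_|k IH kN].
  (* The only diagram of size 0 is the empty one, of mass 1. *)
  have p0 : perm_eq (padded N 0) [:: nseq N 0%N].
    apply: uniq_perm => //; first exact: padded_uniq.
    move=> s; rewrite mem_padded // inE; apply/and3P/eqP => [[/eqP sN _ /eqP s0]|->].
      apply: (@eq_from_nth _ 0%N); first by rewrite size_nseq.
      move=> i _; rewrite nth_nseq if_same; apply/eqP.
      by rewrite -leqn0 (leq_trans (leq_nth_sumn s i)) ?s0.
    rewrite size_nseq eqxx sumn_nseq mul0n eqxx; split => //.
    by apply/sorted_geqP => i; rewrite !nth_nseq !if_same.
  rewrite /expect (perm_big _ p0) big_seq1 mulr1 /jackmass sumn_nseq mul0n mul1r.
  suff -> : hook alpha (nseq N 0) = 1 by rewrite divr1.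
  by elim: (N) => //= M ->; rewrite /rowhook big_nil mulr1.
rewrite expect_grow // -[RHS]IH ?(ltnW kN) //.
apply: eq_expect => [|t tN st tk]; first exact: ltnW.
have := @upw_moment_lt t 0; rewrite tk => /(_ kN st tN isT) M0; rewrite -[RHS]M0.
by apply: eq_bigr => r _; rewrite expr0.
Qed.

Lemma contentsum_incr t r : (r < size t)%N ->
  contentsum alpha (incr_nth t r) = contentsum alpha t + xrow alpha t r.
Proof.
move=> rt; rewrite /contentsum size_incr_nth rt.
have rin : r \in iota 0 (size t) by rewrite mem_iota.
rewrite (bigD1_seq r rin (iota_uniq _ _)) [in RHS](bigD1_seq r rin (iota_uniq _ _)) /=.
rewrite nth_incr_nth eqxx add1n iota0Sr big_rcons /= -/(xrow alpha t r).
rewrite [X in _ + X](eq_bigr (fun i => \sum_(j <- iota 0 (nth 0%N t i)) (alpha * j%:R - i%:R))).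
  by rewrite addrAC.
by move=> i ir; rewrite nth_incr_nth eq_sym (negbTE ir).
Qed.

Lemma contentsum_nseq0 M : contentsum alpha (nseq M 0%N) = 0.
Proof.
rewrite /contentsum big1_seq // => i _; rewrite nth_nseq if_same big_nil //.
Qed.

(** Given the diagram, the content of the next box has mean 0 and variance
alpha * k, so the content sum is a martingale and the variances add up. *)
Lemma expect_contentsum_sqr k : (k <= N)%N ->
  E k (fun s => contentsum alpha s ^+ 2) = alpha * (k%:R * (k%:R - 1) / 2%:R).
Proof.
elim: k => [_|k IH kN].
  rewrite mul0r mul0r mulr0.
  rewrite -[RHS](mulr0 (E 0 (fun=> 0))) [RHS]mulrC -expectZ.
  apply: eq_expect => // s sN _ s0; rewrite (_ : s = nseq N 0%N); last first.
    apply: (@eq_from_nth _ 0%N); first by rewrite size_nseq.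
    move=> i _; rewrite nth_nseq if_same; apply/eqP.
    by rewrite -leqn0 (leq_trans (leq_nth_sumn s i)) ?s0.
  by rewrite contentsum_nseq0 mul0r expr0n.
rewrite expect_grow //.
rewrite (_ : _ * _ = alpha * (k%:R * (k%:R - 1) / 2%:R) + alpha * k%:R * 1); last first.
  by rewrite -natr1; field.
rewrite -[X in _ + _ * X](expect1 (ltnW kN)) -expectZ -IH ?(ltnW kN) // -expectD.
apply: eq_expect => [|t tN st tk]; first exact: ltnW.
have M e := @upw_moment_lt t e; rewrite tk in M.
have := M 0%N kN st tN isT; have := M 1%N kN st tN isT; have := M 2%N kN st tN isT.
rewrite /= => M2 M1 M0.
transitivity (contentsum alpha t ^+ 2 * (\sum_(r <- iota 0 N) upw alpha N t r * xrow alpha t r ^+ 0)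
  + 2%:R * contentsum alpha t * (\sum_(r <- iota 0 N) upw alpha N t r * xrow alpha t r ^+ 1)
  + \sum_(r <- iota 0 N) upw alpha N t r * xrow alpha t r ^+ 2); last first.
  by rewrite M0 M1 M2; ring.
rewrite [contentsum alpha t ^+ 2 * _]mulr_sumr
  [2%:R * contentsum alpha t * _]mulr_sumr -!big_split /=; apply: eq_big_seq => r; rewrite mem_iota /= => rN.
by rewrite contentsum_incr ?tN //; ring.
Qed.

(** Among the rows of a given length only the first one can grow. *)
Lemma upw_equal_rows t j : sorted geq t -> size t = N -> (0 < j)%N ->
  \sum_(r <- iota 0 N | nth 0%N t r == j) upw alpha N t r <= (count_mem j t)%:R / alpha.
Proof.
move=> st tN j0.
have [/hasP[r]|/hasPn noadd] := boolP (has (fun r => addable t r && (nth 0%N t r == j)) (iota 0 N)); last first.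
  rewrite big_seq_cond big1 ?divr_ge0 // ?ltW // => r /andP[rin rj].
  have := noadd r rin; rewrite rj andbT => nadr; rewrite -tN upw_unaddable //.
  by move: rin; rewrite mem_iota tN.
rewrite mem_iota /= => rN /andP[adr /eqP rj].
have rin : r \in iota 0 N by rewrite mem_iota.
rewrite big_mkcond (bigD1_seq r rin (iota_uniq _ _)) /= rj eqxx.
rewrite big_seq_cond big1 ?addr0; last first.
  move=> i /andP[]; rewrite mem_iota /= => iN ir; case: eqP => // ij.
  rewrite -tN upw_unaddable ?tN //; apply: contraL adr => adi.
  (* Of two rows of equal length the lower one is not addable. *)
  case: (ltngtP i r) ir => // ir _.
    rewrite /addable negb_or -lt0n -leqNgt (leq_trans _ ir) //= rj -ij.
    by apply: nth_geq => //; lia.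
  move: adi; rewrite /addable gtn_eqF ?(leq_trans _ ir) //= ij -rj ltnNge.
  by rewrite nth_geq //; lia.
by rewrite -tN -rj upw_le // ?tN // rj.
Qed.

(** A new row longer than j + 1 appears when a row of length j + 1 grows, which has
probability at most 1 / alpha times the number of such rows; sum over the k steps and
iterate over j. *)
Lemma expect_long_rows k j : (k <= N)%N ->
  E k (fun s => (count (fun q => j < q)%N s)%:R) <= k%:R * (N%:R / alpha) ^+ j.
Proof.
elim: j k => [|j IHj] k kN.
  have -> : k%:R * (N%:R / alpha) ^+ 0 = E k (fun=> k%:R * 1).
    by rewrite expectZ expect1.
  apply: le_expect => // s _ _ sk; rewrite mulr1 ler_nat -sk; elim: (s) => //= m u; lia.
elim: k kN => [_|k IHk kN].
  rewrite mul0r -[leRHS](mulr0 (E 0 (fun=> 0))) [leRHS]mulrC -expectZ.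
  apply: le_expect => // s _ _ s0; rewrite mul0r lern0 -leqn0.
  rewrite (@leq_trans (sumn s)) ?s0 // -[leqRHS]s0; elim: (s) => //= m u; lia.
rewrite expect_grow //.
apply: (@le_trans _ _ (E k (fun s => (count (fun q => j.+1 < q)%N s)%:R) +
   alpha^-1 * E k (fun s => (count (fun q => j < q)%N s)%:R))).
  rewrite -expectZ -expectD; apply: le_expect => [|t tN st tk]; first exact: ltnW.
  have M0 := @upw_moment_lt t 0; rewrite tk in M0; have {M0} := M0 kN st tN isT => M0.
  rewrite (eq_big_seq (fun r => upw alpha N t r * xrow alpha t r ^+ 0 *
     (count (fun q => j.+1 < q)%N t)%:R +
     (if nth 0%N t r == j.+1 then upw alpha N t r else 0))); last first.
    move=> r; rewrite mem_iota /= => rN.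
    have := @count_incr_nth (fun q => j.+1 < q)%N t r; rewrite tN => /(_ rN) /= c.
    have -> : count (fun q => j.+1 < q)%N (incr_nth t r)
       = (count (fun q => j.+1 < q)%N t + (nth 0%N t r == j.+1))%N.
      by move: c; case: eqP => [->|]; case: (ltnP j.+1 (nth 0%N t r)) => ?; lia.
    by rewrite natrD expr0; case: eqP => _ /=; ring.
  rewrite big_split /= -mulr_suml M0 mul1r lerD2l -big_mkcond /=.
  apply: le_trans (upw_equal_rows st tN (ltn0Sn j)) _.
  rewrite mulrC ler_pM2l ?invr_gt0 // ler_nat; apply: sub_count => q /= /eqP -> //.
rewrite -natr1 mulrDl mul1r lerD ?IHk ?(ltnW kN) //.
rewrite exprS -mulrA mulrCA ler_wpM2l ?invr_ge0 ?(ltW a0) //.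
apply: le_trans (IHj k (ltnW kN)) _; rewrite ler_wpM2r ?exprn_ge0 ?divr_ge0 ?(ltW a0) //.
by rewrite ler_nat ltnW.
Qed.

End Growth.

(** * Gaussian tails and the solution of Stein's equation *)

Definition phi (R : realType) (w : R) : R := normal_pdf 0 1 w.
Definition Phi (R : realType) (z : R) : R := fine (normal_prob (0 : R) 1 `]-oo, z]).

Lemma PhiE (R : realType) (z : R) : normal_prob (0 : R) 1 `]-oo, z] = (Phi z)%:E.
Proof. by rewrite /Phi fineK // fin_num_measure. Qed.

Lemma Phi_ge0 (R : realType) (z : R) : 0 <= Phi z.
Proof. by rewrite -lee_fin -PhiE. Qed.

Lemma Phi_le1 (R : realType) (z : R) : Phi z <= 1.
Proof. by rewrite -lee_fin -PhiE probability_le1. Qed.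

Lemma Phi_le (R : realType) (a b : R) : a <= b -> Phi a <= Phi b.
Proof.
move=> ab; rewrite -lee_fin -!PhiE le_measure ?inE //.
by apply: subitvPr.
Qed.

Lemma phiE (R : realType) (w : R) : phi w = normal_peak 1 * expR (- (w ^+ 2 / 2)).
Proof. by rewrite /phi normal_pdfE ?oner_neq0 // /normal_fun subr0 expr1n mulNr. Qed.

Lemma phi_gt0 (R : realType) (w : R) : 0 < phi w.
Proof. by rewrite phiE mulr_gt0 ?expR_gt0 // normal_peak_gt0 ?oner_neq0. Qed.

Lemma is_derive_Phi (R : realType) (w : R) : is_derive w 1 (@Phi R) (phi w).
Proof.
have ww : w < w + 1 by rewrite ltrDl.
have int : (@lebesgue_measure R).-integrable [set` Interval -oo%O (BRight (w + 1))] (EFin \o @phi R).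
  exact: (integrableS _ _ (@subsetT _ _) (integrable_normal_pdf 0 1)).
have [||dF F'] := @continuous_FTC1 R (@phi R) -oo%O w (w + 1) ww int.
- by rewrite ltNyr.
- exact: (@continuous_normal_pdf R 0 1 (oner_neq0 _) w).
have FE : @Phi R = fun x => (\int[lebesgue_measure]_(t in [set` Interval -oo%O (BRight x)]) (phi t))%R.
  by [].
rewrite FE -F' derive1E; exact: derivableP.
Qed.

(** The identity as a random variable: its distribution function under the normal law
is [Phi], whose limits at infinity then come from the general theory. *)
Definition identity_rv (R : realType) : measurableTypeR R -> R := idfun.

HB.instance Definition _ (R : realType) :=
  @isMeasurableFun.Build _ _ _ _ (@identity_rv R) (@measurable_id _ _ setT).

Lemma Phi_Ny (R : realType) (e : R) : 0 < e -> exists M, forall w, w <= M -> Phi w <= e.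
Proof.
move=> e0; pose P : probability (measurableTypeR R) R := normal_prob (0 : R) 1.
have /fine_cvg := cvg_cdfNy0 ((@identity_rv R) : {RV P >-> R}).
move=> /cvgrPdist_le /(_ _ e0)[M [_ MP]]; exists (M - 1) => w wM.
have /MP : w < M by lra.
rewrite /= sub0r normrN ger0_norm; last exact: Phi_ge0.
by [].
Qed.

Lemma Phi_y (R : realType) (e : R) : 0 < e -> exists M, forall w, M <= w -> 1 - Phi w <= e.
Proof.
move=> e0; pose P : probability (measurableTypeR R) R := normal_prob (0 : R) 1.
have /fine_cvg := cvg_cdfy1 ((@identity_rv R) : {RV P >-> R}).
move=> /cvgrPdist_le /(_ _ e0)[M [_ MP]]; exists (M + 1) => w wM.
have /MP : M < w by lra.
rewrite /= ger0_norm //; rewrite subr_ge0; exact: Phi_le1.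
Qed.

Lemma is_derive_mul (R : realType) (f g : R -> R) (x df dg : R) :
  is_derive x 1 f df -> is_derive x 1 g dg ->
  is_derive x 1 (fun t => f t * g t) (df * g x + f x * dg).
Proof.
move=> hf hg; have := is_deriveM hf hg; move=> /is_derive_eq; apply.
by rewrite /GRing.scale /= addrC mulrC.
Qed.

Lemma is_derive_gauss (R : realType) (c w : R) :
  is_derive w 1 (fun t => expR (c * t ^+ 2)) (2 * c * w * expR (c * w ^+ 2)).
Proof.
have h1 : is_derive w 1 (fun t : R => c * t ^+ 2) (c * (2 * w)).
  have := is_deriveZ c (is_deriveX 2 (is_derive_id w (1 : R))).
  move=> /is_derive_eq; apply; rewrite /GRing.scale /= expr1; ring.
have := @is_derive1_comp R expR (fun t => c * t ^+ 2) w _ _ (is_derive_expR _) h1.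
move=> /is_derive_eq; apply; ring.
Qed.

Lemma is_derive_phi (R : realType) (w : R) : is_derive w 1 (@phi R) (- w * phi w).
Proof.
have -> : @phi R = fun w => normal_peak 1 * expR ((- 2^-1) * w ^+ 2).
  by apply/funext => x; rewrite phiE; congr (_ * expR _); field.
have := is_derive_mul (is_derive_cst (normal_peak 1 : R) w 1) (is_derive_gauss (- 2^-1) w).
by move=> /is_derive_eq; apply; rewrite /cst; field.
Qed.

(** The inverse of [phi], in a form that can be differentiated directly. *)
Definition phiV (R : realType) (w : R) : R := (normal_peak 1)^-1 * expR (2^-1 * w ^+ 2).

Lemma phiVE (R : realType) (w : R) : phiV w = (phi w)^-1.
Proof. by rewrite /phiV phiE invfM -expRN opprK [_ / 2]mulrC. Qed.

Lemma is_derive_phiV (R : realType) (w : R) : is_derive w 1 (@phiV R) (w * phiV w).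
Proof.
have := is_derive_mul (is_derive_cst ((normal_peak 1)^-1 : R) w 1) (is_derive_gauss (2^-1) w).
move=> /is_derive_eq; apply; rewrite /phiV /cst; field.
by rewrite gt_eqF // normal_peak_gt0 ?oner_neq0.
Qed.

Lemma mean_value (R : realType) (f df : R -> R) (a b : R) : a <= b ->
  (forall x, a <= x <= b -> is_derive x 1 f (df x)) ->
  exists2 c, a <= c <= b & f b - f a = df c * (b - a).
Proof.
move=> ab fdf.
have [|| c] := @MVT_segment R f df a b ab.
- by move=> x; rewrite in_itv /= => /andP[ax xb]; apply: fdf; rewrite !ltW.
- apply: derivable_within_continuous => x; rewrite in_itv /= => /fdf h.
  exact: ex_derive.
- by rewrite in_itv /= => cab fab; exists c.
Qed.

(** The function t |-> G t + phi t / t has derivative - phi t / t ^ 2, hence is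
nonincreasing on the negative axis; compare w with a point where G is small. Stated
for any primitive G of [phi] vanishing at -oo, so as to cover both Gaussian tails. *)
Lemma mills_ratio (R : realType) (G : R -> R) (w : R) :
  (forall t : R, is_derive t 1 G (phi t)) ->
  (forall e, 0 < e -> exists M, forall t, t <= M -> G t <= e) ->
  w < 0 -> G w * (- w) <= phi w.
Proof.
move=> dG G0 w0.
rewrite -ler_pdivlMr ?oppr_gt0 //; apply/ler_addgt0Pr => e e0.
have [M GM] := G0 e e0; set m := Num.min M w.
have mw : m <= w by rewrite ge_min lexx orbT.
pose h t := G t + phi t * t^-1.
have dh t : m <= t <= w -> is_derive t 1 h (- (phi t * (t^-1) ^+ 2)).
  case/andP=> _ tw; have t0 : t != 0 by rewrite lt_eqF // (le_lt_trans tw).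
  have := is_derive_mul (is_derive_phi t) (is_deriveV t0 (is_derive_id t 1)).
  move=> /(is_deriveD (dG t))/is_derive_eq; apply.
  by rewrite /GRing.scale /=; field.
have [c /andP[mc cw] hE] := mean_value mw dh.
have hw : h w <= h m.
  rewrite -subr_le0 hE mulr_le0_ge0 ?subr_ge0 // oppr_le0.
  by rewrite mulr_ge0 ?sqr_ge0 // ltW ?phi_gt0.
have hm : h m <= e.
  rewrite /h (le_trans _ (GM m _)) ?ge_min ?lexx //.
  rewrite gerDl mulr_ge0_le0 ?ltW ?phi_gt0 // invr_lt0.
  exact: le_lt_trans mw w0.
have := le_trans hw hm; rewrite /h invrN mulrN.
by move: (phi w / w) => q; lra.
Qed.

Lemma mills_left (R : realType) (w : R) : w < 0 -> Phi w * (- w) <= phi w.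
Proof. by apply: mills_ratio => [t|e]; [exact: is_derive_Phi|exact: Phi_Ny]. Qed.

Lemma phiN (R : realType) (w : R) : phi (- w) = phi w.
Proof. by rewrite !phiE sqrrN. Qed.

Lemma mills_right (R : realType) (w : R) : 0 < w -> (1 - Phi w) * w <= phi w.
Proof.
move=> w0; rewrite -phiN -[X in _ * X]opprK -[X in 1 - Phi X]opprK.
apply: (@mills_ratio R (fun t => 1 - Phi (- t))); last by rewrite oppr_lt0.
- move=> t; have d1 : is_derive t 1 (fun t : R => - t) (- 1 : R) by exact: is_deriveNid.
  have := @is_derive1_comp R (@Phi R) (fun t => - t) t _ _ (is_derive_Phi _) d1.
  move=> /(is_deriveB (is_derive_cst (1 : R) t 1))/is_derive_eq; apply.
  by rewrite phiN; ring.
- move=> e e0; have [M PM] := Phi_y e0; exists (- M) => t tM.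
  by apply: PM; rewrite lerNr.
Qed.

(** The supremum over z of the solution [stein z] of Stein's equation at w. *)
Definition tailprod (R : realType) (w : R) : R := Phi w * (1 - Phi w) * phiV w.

Lemma phiV_gt0 (R : realType) (w : R) : 0 < phiV w.
Proof. by rewrite phiVE invr_gt0 phi_gt0. Qed.

Lemma tailprod_ge0 (R : realType) (w : R) : 0 <= tailprod w.
Proof.
apply: mulr_ge0 (mulr_ge0 (Phi_ge0 w) _) (ltW (phiV_gt0 w)).
by rewrite subr_ge0 Phi_le1.
Qed.

Lemma norm_tailprod_le1 (R : realType) (w : R) : `|w| * tailprod w <= 1.
Proof.
have P0 := Phi_ge0 w; have P1 := Phi_le1 w; have i0 := phiV_gt0 w; have p0 := phi_gt0 w.
have [w0|w0|->] := ltgtP w 0; last by rewrite normr0 mul0r.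
- rewrite ltr0_norm // /tailprod phiVE mulrA ler_pdivrMr // mul1r.
  rewrite mulrA mulrC; apply: le_trans (mills_left w0).
  by rewrite -[leRHS]mul1r [- w * _]mulrC ler_wpM2r ?mulr_ge0 ?oppr_ge0 ?(ltW w0) //; lra.
- rewrite gtr0_norm // /tailprod phiVE mulrA ler_pdivrMr // mul1r.
  rewrite mulrCA; apply: le_trans (mills_right w0).
  by rewrite -[leRHS]mul1r [w * _]mulrC ler_wpM2r ?mulr_ge0 ?(ltW w0) // subr_ge0.
Qed.

Definition stein_bound (R : realType) : R := 1 + phiV 1.

Lemma tailprod_le (R : realType) (w : R) : tailprod w <= stein_bound R.
Proof.
have i1 := phiV_gt0 (1 : R).
have [w1|w1] := leP 1 `|w|.
  apply: (@le_trans _ _ 1); last by rewrite /stein_bound lerDl ltW.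
  apply: le_trans (norm_tailprod_le1 w).
  by rewrite -[leLHS]mul1r ler_wpM2r ?tailprod_ge0.
apply: (@le_trans _ _ (phiV 1)); last by rewrite /stein_bound lerDr.
have iw : phiV w <= phiV 1.
  have pk : 0 < (normal_peak 1)^-1 :> R by rewrite invr_gt0 normal_peak_gt0 ?oner_neq0.
  rewrite /phiV (ler_pM2l pk) ler_expR.
  by rewrite ler_pM2l ?invr_gt0 // -[w ^+ 2]real_normK ?num_real // ler_pXn2r ?nnegrE // ltW.
apply: le_trans iw; rewrite /tailprod ler_piMl ?(ltW (phiV_gt0 _)) //.
have P0 := Phi_ge0 w; have P1 := Phi_le1 w; nra.
Qed.

(** The two branches of the solution [stein] are kept as functions on the whole line,
where they are smooth. *)
Definition steinL (R : realType) (z w : R) : R := (1 - Phi z) * (Phi w * phiV w).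
Definition steinR (R : realType) (z w : R) : R := Phi z * ((1 - Phi w) * phiV w).
(** The bounded solution of Stein's equation
f' w - w * f w = (w <= z) - Phi z. *)
Definition stein (R : realType) (z w : R) : R :=
  if w <= z then steinL z w else steinR z w.
Definition drift (R : realType) (z w : R) : R := w * stein z w.
(** By Stein's equation this is a primitive of [drift z]. Unlike the derivative of
[stein z], the function [drift z] is continuous across z. *)
Definition driftint (R : realType) (z w : R) : R :=
  stein z w - Num.min w z + Phi z * w.

Lemma stein_bounds (R : realType) (z w : R) : 0 <= stein z w <= tailprod w.
Proof.
have i0 := phiV_gt0 w; have := @Phi_le R.
have Pz := Phi_ge0 z; have Pz1 := Phi_le1 z; have Pw := Phi_ge0 w; have Pw1 := Phi_le1 w.
rewrite /stein /steinL /steinR /tailprod => mono.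
case: ifPn => [/mono wz|]; last rewrite -ltNge => /ltW/mono zw.
  apply/andP; split; first by apply: mulr_ge0; [lra|apply: mulr_ge0; lra].
  by rewrite mulrA ler_pM2r // mulrC ler_wpM2l // lerB.
apply/andP; split; first by apply: mulr_ge0; [lra|apply: mulr_ge0; lra].
by rewrite mulrA ler_pM2r // ler_wpM2r // subr_ge0.
Qed.

Lemma drift_le1 (R : realType) (z w : R) : `|drift z w| <= 1.
Proof.
have /andP[s0 s1] := stein_bounds z w.
rewrite /drift normrM (ger0_norm s0); apply: le_trans (norm_tailprod_le1 w).
by rewrite ler_wpM2l.
Qed.

(** * Increments across the jump of Stein's equation *)

Lemma phi_phiV (R : realType) (w : R) : phi w * phiV w = 1.
Proof. by rewrite phiVE divff // gt_eqF // phi_gt0. Qed.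

Lemma is_derive_steinL (R : realType) (z w : R) :
  is_derive w 1 (steinL z) (1 - Phi z + w * steinL z w).
Proof.
have := is_derive_mul (is_derive_Phi w) (is_derive_phiV w).
move=> /(is_deriveZ (1 - Phi z)) /is_derive_eq; apply.
by rewrite /GRing.scale /= phi_phiV /steinL; ring.
Qed.

Lemma is_derive_steinR (R : realType) (z w : R) :
  is_derive w 1 (steinR z) (- Phi z + w * steinR z w).
Proof.
have := is_derive_mul (is_deriveB (is_derive_cst (1 : R) w 1) (is_derive_Phi w)) (is_derive_phiV w).
move=> /(is_deriveZ (Phi z)) /is_derive_eq; apply.
rewrite /GRing.scale /= !fctE sub0r mulNr phi_phiV /steinR; ring.
Qed.

Lemma stein_le (R : realType) (z w : R) : w <= z -> stein z w = steinL z w.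
Proof. by rewrite /stein => ->. Qed.

Lemma stein_ge (R : realType) (z w : R) : z <= w -> stein z w = steinR z w.
Proof.
rewrite /stein le_eqVlt => /predU1P[<-|zw]; last by rewrite leNgt zw.
by rewrite lexx /steinL /steinR; ring.
Qed.

Lemma is_derive_lin (R : realType) (c w : R) : is_derive w 1 (fun t : R => c * t) c.
Proof.
have := is_deriveZ c (is_derive_id w (1 : R)).
by move=> /is_derive_eq; apply; rewrite /GRing.scale /= mulr1.
Qed.

(** The mean value theorem on each side of z, where [driftint z] is smooth. *)
Lemma driftint_increment (R : realType) (z a b G e : R) : a <= b ->
  (forall c, a <= c <= b -> `|drift z c - G| <= e) ->
  `|driftint z b - driftint z a - G * (b - a)| <= e * (b - a).
Proof.
have below x y : x <= y -> y <= z ->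
  exists2 c, x <= c <= y & driftint z y - driftint z x = drift z c * (y - x).
  move=> xy yz.
  have dF c : x <= c <= y -> is_derive c 1 (fun t => steinL z t + (Phi z - 1) * t) (drift z c).
    case/andP=> _ cy; rewrite /drift stein_le; last exact: le_trans yz.
    have := is_deriveD (is_derive_steinL z c) (is_derive_lin (Phi z - 1) c).
    by move=> /is_derive_eq; apply; ring.
  have [c cxy E] := mean_value xy dF; exists c => //; rewrite -E /driftint.
  have xz := le_trans xy yz.
  by rewrite !stein_le // !min_l //; ring.
have above x y : x <= y -> z <= x ->
  exists2 c, x <= c <= y & driftint z y - driftint z x = drift z c * (y - x).
  move=> xy zx.
  have dF c : x <= c <= y -> is_derive c 1 (fun t => steinR z t + Phi z * t) (drift z c).
    case/andP=> xc _; rewrite /drift stein_ge; last exact: le_trans xc.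
    have := is_deriveD (is_derive_steinR z c) (is_derive_lin (Phi z) c).
    by move=> /is_derive_eq; apply; ring.
  have [c cxy E] := mean_value xy dF; exists c => //; rewrite -E /driftint.
  have zy := le_trans zx xy.
  by rewrite !stein_ge // !min_r //; ring.
have conclude x y : x <= y -> (forall c, x <= c <= y -> `|drift z c - G| <= e) ->
    (exists2 c, x <= c <= y & driftint z y - driftint z x = drift z c * (y - x)) ->
    `|driftint z y - driftint z x - G * (y - x)| <= e * (y - x).
  move=> xy Ge [c cxy ->]; rewrite -mulrBl normrM (ger0_norm (_ : 0 <= y - x)) ?subr_ge0 //.
  by rewrite ler_wpM2r ?subr_ge0 // Ge.
move=> ab Ge.
have [bz|zb] := leP b z; first by apply: conclude => //; exact: below.
have [za|az] := leP z a; first by apply: conclude => //; exact: above.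
have h1 : `|driftint z z - driftint z a - G * (z - a)| <= e * (z - a).
  apply: conclude => [|c /andP[ac cz]|]; [exact: ltW| |exact: below (ltW az) (lexx z)].
  by apply: Ge; rewrite ac (le_trans cz) // ltW.
have h2 : `|driftint z b - driftint z z - G * (b - z)| <= e * (b - z).
  apply: conclude => [|c /andP[zc cb]|]; [exact: ltW| |exact: above (ltW zb) (lexx z)].
  by apply: Ge; rewrite cb (le_trans _ zc) // ltW.
have := lerD h1 h2; rewrite -mulrDr (addrC (z - a)) addrA subrK => h12.
apply: le_trans h12; apply: le_trans (ler_normD _ _).
by rewrite le_eqVlt; apply/orP; left; apply/eqP; congr `|_|; ring.
Qed.

(** By Stein's equation the derivative of [drift z] at c is
s + c * (t + c * s), with s = stein z c and t one of 1 - Phi z and - Phi z. *)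
Lemma drift_lipschitz (R : realType) (z a b M : R) : a <= b -> `|a| <= M -> `|b| <= M ->
  `|drift z b - drift z a| <= (stein_bound R + 2 * M) * (b - a).
Proof.
(* The bound on the derivative of the drift common to both sides of z. *)
have dom (c s t A : R) : `|c| <= M -> 0 <= s <= stein_bound R -> `|c * s| <= 1 -> 0 <= A <= 1 ->
    (t = A \/ t = - A) -> `|s + c * (t + c * s)| <= stein_bound R + 2 * M.
  move=> cM /andP[s0 sC] cs /andP[A0 A1] tA.
  apply: le_trans (ler_normD _ _) _; rewrite (ger0_norm s0) normrM.
  have M0 : 0 <= M by apply: le_trans cM.
  apply: lerD => //; rewrite [2 * M]mulrC; apply: ler_pM => //.
  apply: le_trans (ler_normD _ _) _.
  have -> : `|t| = A by case: tA => ->; rewrite ?normrN ger0_norm.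
  lra.
have bet x y c : `|x| <= M -> `|y| <= M -> x <= c <= y -> `|c| <= M.
  by rewrite !ler_norml => /andP[? ?] /andP[? ?] /andP[? ?]; apply/andP; split; lra.
have below x y : x <= y -> y <= z -> `|x| <= M -> `|y| <= M ->
    `|drift z y - drift z x| <= (stein_bound R + 2 * M) * (y - x).
  move=> xy yz xM yM.
  have dF c : x <= c <= y -> is_derive c 1 (fun t => t * steinL z t)
      (steinL z c + c * (1 - Phi z + c * steinL z c)).
    move=> _; have := is_derive_mul (is_derive_id c (1 : R)) (is_derive_steinL z c).
    by move=> /is_derive_eq; apply; rewrite mul1r.
  have [c cxy] := mean_value xy dF.
  rewrite /drift !stein_le //; last exact: le_trans yz.
  move=> ->; rewrite normrM (ger0_norm (_ : 0 <= y - x)) ?subr_ge0 // ler_wpM2r ?subr_ge0 //.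
  have cz : c <= z by case/andP: cxy => _ cy; exact: le_trans yz.
  have := stein_bounds z c; have := drift_le1 z c; rewrite /drift stein_le // => d1 /andP[s0 s1].
  apply: (@dom _ _ _ (1 - Phi z)) => //; last by left.
  - exact: bet cxy.
  - by rewrite s0 (le_trans s1) // tailprod_le.
  - by have := Phi_ge0 z; have := Phi_le1 z; lra.
have above x y : x <= y -> z <= x -> `|x| <= M -> `|y| <= M ->
    `|drift z y - drift z x| <= (stein_bound R + 2 * M) * (y - x).
  move=> xy zx xM yM.
  have dF c : x <= c <= y -> is_derive c 1 (fun t => t * steinR z t)
      (steinR z c + c * (- Phi z + c * steinR z c)).
    move=> _; have := is_derive_mul (is_derive_id c (1 : R)) (is_derive_steinR z c).
    by move=> /is_derive_eq; apply; rewrite mul1r.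
  have [c cxy] := mean_value xy dF.
  rewrite /drift !stein_ge //; last exact: le_trans xy.
  move=> ->; rewrite normrM (ger0_norm (_ : 0 <= y - x)) ?subr_ge0 // ler_wpM2r ?subr_ge0 //.
  have zc : z <= c by case/andP: cxy => xc _; exact: le_trans xc.
  have := stein_bounds z c; have := drift_le1 z c; rewrite /drift stein_ge // => d1 /andP[s0 s1].
  apply: (@dom _ _ _ (Phi z)) => //; last by right.
  - exact: bet cxy.
  - by rewrite s0 (le_trans s1) // tailprod_le.
  - by rewrite Phi_ge0 Phi_le1.
move=> ab aM bM.
have [bz|zb] := leP b z; first exact: below.
have [za|az] := leP z a; first exact: above.
have zM : `|z| <= M by apply: (bet a b) => //; rewrite !ltW.
have h1 := below a z (ltW az) (lexx z) aM zM.
have h2 := above z b (ltW zb) (lexx z) zM bM.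
have := lerD h1 h2; rewrite -mulrDr (addrC (z - a)) addrA subrK => h12.
apply: le_trans h12; rewrite -[leLHS](_ : `|(drift z z - drift z a) + (drift z b - drift z z)| = _).
  exact: ler_normD.
by congr `|_|; ring.
Qed.

Lemma driftint_local (R : realType) (z a b w M D : R) :
  `|a| <= M -> `|b| <= M -> `|w| <= M -> `|a - w| <= D -> `|b - w| <= D ->
  `|driftint z b - driftint z a - drift z w * (b - a)| <= (stein_bound R + 2 * M) * D * `|b - a|.
Proof.
wlog ab : a b / a <= b => [hw|] aM bM wM awD bwD.
  have [ab|/ltW ba] := leP a b; first exact: hw.
  have := hw b a ba bM aM wM bwD awD; rewrite -normrN [`|a - b|]distrC.
  by congr (`|_| <= _); ring.
rewrite (ger0_norm (_ : 0 <= b - a)) ?subr_ge0 //.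
apply: driftint_increment => // c /andP[ac cb].
have C0 : 0 <= stein_bound R + 2 * M.
  have := phiV_gt0 (1 : R); have : 0 <= M by apply: le_trans aM.
  by rewrite /stein_bound; lra.
have cM : `|c| <= M.
  by move: aM bM; rewrite !ler_norml => /andP[? ?] /andP[? ?]; apply/andP; split; lra.
have cwD : `|c - w| <= D.
  by move: awD bwD; rewrite !ler_norml => /andP[? ?] /andP[? ?]; apply/andP; split; lra.
have [wc|/ltW cw] := leP w c.
  apply: le_trans (drift_lipschitz z wc wM cM) _.
  by rewrite ler_wpM2l // (le_trans _ cwD) // ler_norm.
rewrite distrC; apply: le_trans (drift_lipschitz z cw cM wM) _.
by rewrite ler_wpM2l // (le_trans _ cwD) // distrC ler_norm.
Qed.

Lemma driftint_global (R : realType) (z a b w : R) :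
  `|driftint z b - driftint z a - drift z w * (b - a)| <= 2 * `|b - a|.
Proof.
wlog ab : a b / a <= b => [hw|].
  have [ab|/ltW ba] := leP a b; first exact: hw.
  have := hw b a ba; rewrite -normrN [`|a - b|]distrC.
  by congr (`|_| <= _); ring.
rewrite (ger0_norm (_ : 0 <= b - a)) ?subr_ge0 //.
apply: driftint_increment => // c _; apply: le_trans (ler_normB _ _) _.
by have := drift_le1 z c; have := drift_le1 z w; lra.
Qed.

Lemma normal_peak_le1 (R : realType) : normal_peak 1 <= 1 :> R.
Proof.
rewrite /normal_peak expr1n mul1r invf_le1; last by rewrite sqrtr_gt0 mulrn_wgt0 // pi_gt0.
rewrite -[leLHS]sqrtr1 ler_sqrt; last by rewrite mulrn_wge0 // pi_ge0.
by have := @pi_ge2 R; rewrite -[pi *+ 2]mulr_natr; lra.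
Qed.

Lemma Phi_lipschitz (R : realType) (a b : R) : a <= b -> Phi b - Phi a <= b - a.
Proof.
move=> ab; have [c _ ->] := mean_value ab (fun x _ => is_derive_Phi x).
rewrite -[leRHS]mul1r ler_wpM2r ?subr_ge0 //; apply: le_trans (@normal_peak_le1 R).
by apply: normal_pdf_ub; rewrite oner_neq0.
Qed.

(** * A Kolmogorov bound from approximate zero-biasing *)

Lemma min_increment (R : realType) (v x z : R) :
  0 <= x * (Num.min (v + x) z - Num.min v z) <= x ^+ 2.
Proof.
by case: (leP (v + x) z) => ?; case: (leP v z) => ?; apply/andP; split; nra.
Qed.

Section ZeroBias.
Variables (R : realType) (T : eqType) (ts : seq T) (I : eqType) (rs : seq I).
Variables (m : T -> R) (p xi : T -> I -> R) (v : T -> R) (bad : pred T) (a delta : R).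
Hypothesis m_ge0 : forall t, t \in ts -> 0 <= m t.
Hypothesis m_mass : \sum_(t <- ts) m t = 1.
Hypothesis v_var : \sum_(t <- ts) m t * v t ^+ 2 <= 1.
Hypothesis p_ge0 : forall t r, t \in ts -> r \in rs -> 0 <= p t r.
Hypothesis p_mass : forall t, t \in ts -> \sum_(r <- rs) p t r = 1.
Hypothesis p_mean : forall t, t \in ts -> \sum_(r <- rs) p t r * xi t r = 0.
Hypothesis p_var : forall t, t \in ts -> \sum_(r <- rs) p t r * xi t r ^+ 2 = a.
Hypothesis a_gt0 : 0 < a.
Hypothesis delta_ge0 : 0 <= delta.
Hypothesis delta_le1 : delta <= 1.
Hypothesis xi_le : forall t r, t \in ts -> ~~ bad t -> r \in rs -> `|xi t r| <= delta.
Hypothesis linear_regression : forall f : R -> R,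
  \sum_(t <- ts) m t * \sum_(r <- rs) p t r * ((v t + xi t r) * f (v t + xi t r))
  = a^-1 * \sum_(t <- ts) m t * \sum_(r <- rs) p t r * (xi t r * f (v t + xi t r)).

Let beta := \sum_(t <- ts | bad t) m t.

(** The conditional distribution function at z of the zero-biased variable given t.
The zero-biased variable has density a^-1 * p t r * |xi t r| on the segment from v t
to v t + xi t r, and the increment of min is the signed length of the part of that
segment below z. *)
Definition zbcdf (t : T) (z : R) : R :=
  a^-1 * \sum_(r <- rs) p t r * (xi t r * (Num.min (v t + xi t r) z - Num.min (v t) z)).

Lemma row_average_le t F L : t \in ts -> (forall r, r \in rs -> F r <= L) ->
  \sum_(r <- rs) p t r * F r <= L.
Proof.
move=> tin FL; rewrite -[leRHS]mul1r -(p_mass tin) mulr_suml big_seq [leRHS]big_seq.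
by apply: ler_sum => r rin; rewrite ler_wpM2l ?p_ge0 ?FL.
Qed.

Lemma le_row_average t F L : t \in ts -> (forall r, r \in rs -> L <= F r) ->
  L <= \sum_(r <- rs) p t r * F r.
Proof.
move=> tin FL; rewrite -[leLHS]mul1r -(p_mass tin) mulr_suml big_seq [leRHS]big_seq.
by apply: ler_sum => r rin; rewrite ler_wpM2l ?p_ge0 ?FL.
Qed.

(** The weights a^-1 * p t r * xi t r ^+ 2 sum to 1. *)
Lemma row_variance_average t F L : t \in ts ->
  (forall r, r \in rs -> `|F r| <= L * `|xi t r|) ->
  `|a^-1 * \sum_(r <- rs) p t r * (xi t r * F r)| <= L.
Proof.
move=> tin FL; rewrite normrM ger0_norm ?invr_ge0 ?(ltW a_gt0) // mulrC ler_pdivrMr //.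
rewrite -(p_var tin) mulr_sumr; apply: le_trans (ler_norm_sum _ _ _) _.
rewrite big_seq [leRHS]big_seq; apply: ler_sum => r rin.
rewrite normrM (ger0_norm (p_ge0 tin rin)) mulrCA ler_wpM2l ?p_ge0 // normrM.
rewrite -[xi t r ^+ 2]real_normK ?num_real // expr2 mulrA [leRHS]mulrC.
by rewrite ler_wpM2l // FL.
Qed.

Lemma average_le (F G : T -> R) : (forall t, t \in ts -> F t <= G t) ->
  \sum_(t <- ts) m t * F t <= \sum_(t <- ts) m t * G t.
Proof.
move=> FG; rewrite big_seq [leRHS]big_seq; apply: ler_sum => t tin.
by rewrite ler_wpM2l ?m_ge0 ?FG.
Qed.

Lemma average_bad : \sum_(t <- ts) m t * (bad t)%:R = beta.
Proof.
rewrite /beta [RHS]big_mkcond; apply: eq_bigr => t _.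
by case: (bad t); rewrite ?mulr1 ?mulr0.
Qed.

(** Integrate Stein's equation along the zero-biasing segments: the indicator gives
[zbcdf], and what remains compares [drift z] at the original variable with its
average over a segment. *)
Lemma zbcdf_decomposition z :
  \sum_(t <- ts) m t * zbcdf t z - Phi z =
  \sum_(t <- ts) m t * \sum_(r' <- rs) p t r' *
    (a^-1 * \sum_(r <- rs) p t r * (xi t r *
      (drift z (v t + xi t r') * xi t r
       - (driftint z (v t + xi t r) - driftint z (v t))))).
Proof.
have := linear_regression (stein z) => E.
have a0 : a != 0 by rewrite gt_eqF.
have avg t : t \in ts -> a^-1 * \sum_(r <- rs) p t r * (xi t r * stein z (v t + xi t r)) =
    a^-1 * (\sum_(r <- rs) p t r * (xi t r * (driftint z (v t + xi t r) - driftint z (v t))))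
    + zbcdf t z - Phi z.
  move=> tin; rewrite /zbcdf.
  rewrite -[Phi z]mulr1 -(mulVf a0) mulrCA -!mulrDr -mulrBr; congr (_ * _).
  rewrite -(p_var tin) mulr_sumr -big_split -sumrB /=.
  have s0 : stein z (v t) * \sum_(r <- rs) p t r * xi t r = 0 by rewrite p_mean ?mulr0.
  rewrite -[LHS]subr0 -[X in _ - X]s0 mulr_sumr -sumrB.
  by apply: eq_bigr => r _; rewrite /driftint; ring.
rewrite mulr_sumr in E.
transitivity (\sum_(t <- ts) m t * (\sum_(r <- rs) p t r * drift z (v t + xi t r) -
   a^-1 * (\sum_(r <- rs) p t r * (xi t r * (driftint z (v t + xi t r) - driftint z (v t)))))).
  have PE : Phi z = \sum_(t <- ts) Phi z * m t by rewrite -mulr_sumr m_mass mulr1.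
  rewrite [X in _ - X]PE -sumrB.
  rewrite [RHS](_ : _ = \sum_(t <- ts) m t * (\sum_(r <- rs) p t r * drift z (v t + xi t r))
   - \sum_(t <- ts) m t * (a^-1 * (\sum_(r <- rs) p t r *
     (xi t r * (driftint z (v t + xi t r) - driftint z (v t)))))); last first.
    by rewrite -sumrB; apply: eq_bigr => t _; rewrite mulrBr.
  rewrite E -sumrB; apply: eq_big_seq => t tin.
  by rewrite [a^-1 * (m t * _)]mulrCA avg //; ring.
apply: eq_big_seq => t tin; congr (_ * _).
set S := a^-1 * _; have SE : S = \sum_(r' <- rs) p t r' * S by rewrite -mulr_suml p_mass ?mul1r.
rewrite [X in _ - X]SE -sumrB; apply: eq_bigr => r' _.
rewrite -mulrBr; congr (_ * _).
set d := drift _ _; have dE : d = a^-1 * (d * \sum_(r <- rs) p t r * xi t r ^+ 2).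
  by rewrite p_var // mulrCA mulVf ?mulr1.
rewrite [X in X - _]dE -mulrBr; congr (_ * _).
by rewrite mulr_sumr -sumrB; apply: eq_bigr => r _; ring.
Qed.

(** Outside the bad event the two arguments of [drift z] differ by at most
2 * delta and [drift z] is locally Lipschitz; on the bad event it is bounded. The
growth of the Lipschitz constant is absorbed by the second moment of v. *)
Lemma zbcdf_Phi z : `|\sum_(t <- ts) m t * zbcdf t z - Phi z| <= 2 * (stein_bound R + 5) * delta + 2 * beta.
Proof.
rewrite zbcdf_decomposition.
apply: le_trans (ler_norm_sum _ _ _) _.
have : \sum_(t <- ts) m t * ((stein_bound R + (3 + v t ^+ 2)) * (2 * delta) + 2 * (bad t)%:R)
   <= 2 * (stein_bound R + 5) * delta + 2 * beta.
  rewrite (eq_bigr (fun t => (stein_bound R + 3) * (2 * delta) * m t + 2 * delta * (m t * v t ^+ 2)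
      + 2 * (m t * (bad t)%:R))); last by move=> t _; ring.
  rewrite !big_split -!mulr_sumr /= m_mass average_bad mulr1 lerD2r.
  have : 2 * delta * \sum_(t <- ts) m t * v t ^+ 2 <= 2 * delta * 1.
    by rewrite ler_wpM2l // mulr_ge0.
  by move: (\sum_(t <- ts) m t * v t ^+ 2) (stein_bound R) => S C; have := delta_ge0; lra.
apply: le_trans; rewrite big_seq [leRHS]big_seq; apply: ler_sum => t tin.
rewrite normrM (ger0_norm (m_ge0 tin)) ler_wpM2l ?m_ge0 //.
have C0 : 0 <= stein_bound R by have := phiV_gt0 (1 : R); rewrite /stein_bound; lra.
have main (L : R) : (forall r r', r \in rs -> r' \in rs ->
   `|drift z (v t + xi t r') * xi t r - (driftint z (v t + xi t r) - driftint z (v t))| <= L * `|xi t r|) ->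
  `|\sum_(r' <- rs) p t r' * (a^-1 * \sum_(r <- rs) p t r * (xi t r *
      (drift z (v t + xi t r') * xi t r - (driftint z (v t + xi t r) - driftint z (v t)))))| <= L.
  move=> HL; apply: le_trans (ler_norm_sum _ _ _) _.
  rewrite big_seq (eq_bigr (fun r' => p t r' * `|a^-1 * \sum_(r <- rs) p t r * (xi t r *
      (drift z (v t + xi t r') * xi t r - (driftint z (v t + xi t r) - driftint z (v t))))|)); last first.
    by move=> r' r'in; rewrite normrM ger0_norm ?p_ge0.
  rewrite -big_seq; apply: row_average_le => // r' r'in.
  by apply: row_variance_average => // r rin; exact: HL.
have xvE r : v t + xi t r - v t = xi t r by ring.
have [bt|gt] := boolP (bad t).
  apply: le_trans (_ : _ <= 2) _.
    apply: main => r r' _ _; rewrite distrC.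
    by have := driftint_global z (v t) (v t + xi t r) (v t + xi t r'); rewrite xvE.
  by rewrite mulr1 lerDr mulr_ge0 ?mulr_ge0 // addr_ge0 // addr_ge0 // sqr_ge0.
rewrite mulr0n mulr0 addr0; apply: main => r r' rin r'in; rewrite distrC.
have x1 := xi_le tin gt rin; have x2 := xi_le tin gt r'in.
have tri y : `|y| <= delta -> `|v t + y| <= `|v t| + delta.
  by move=> yd; apply: le_trans (ler_normD _ _) _; rewrite lerD2l.
have := @driftint_local R z (v t) (v t + xi t r) (v t + xi t r') (`|v t| + delta) (2 * delta).
rewrite xvE => H.
apply: le_trans (H _ _ _ _ _) _.
- by rewrite lerDl.
- exact: tri.
- exact: tri.
- rewrite opprD addrA subrr add0r normrN; apply: le_trans x2 _.
  by rewrite mulr_natl mulr2n lerDl.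
- rewrite opprD addrACA subrr add0r; apply: le_trans (ler_normB _ _) _.
  by rewrite mulr_natl mulr2n lerD.
apply: ler_wpM2r => //; apply: ler_wpM2r; first by rewrite mulr_ge0.
have : 2 * `|v t| <= 1 + v t ^+ 2.
  rewrite -[v t ^+ 2]real_normK ?num_real //; have := sqr_ge0 (`|v t| - 1).
  by move: `|v t| => V; rewrite sqrrB1; lra.
by move: delta delta_le1 => d; lra.
Qed.

Lemma zbcdf_ge0 t z : t \in ts -> 0 <= zbcdf t z.
Proof.
move=> tin; rewrite /zbcdf mulr_ge0 ?invr_ge0 ?(ltW a_gt0) //.
rewrite big_seq sumr_ge0 // => r rin; rewrite mulr_ge0 ?p_ge0 //.
by have /andP[] := min_increment (v t) (xi t r) z.
Qed.

Lemma zbcdf_le1 t z : t \in ts -> zbcdf t z <= 1.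
Proof.
move=> tin; rewrite /zbcdf mulrC ler_pdivrMr // mul1r -(p_var tin).
rewrite big_seq [leRHS]big_seq; apply: ler_sum => r rin; rewrite ler_wpM2l ?p_ge0 //.
by have /andP[] := min_increment (v t) (xi t r) z.
Qed.

Lemma zbcdf_eq1 t z : t \in ts -> v t <= z -> (forall r, r \in rs -> v t + xi t r <= z) ->
  zbcdf t z = 1.
Proof.
move=> tin vz vxz; rewrite /zbcdf -[RHS](mulVf (lt0r_neq0 a_gt0)) -(p_var tin); congr (_ * _).
by apply: eq_big_seq => r rin; rewrite !min_l ?vxz //; ring.
Qed.

Lemma zbcdf_eq0 t z : t \in ts -> z <= v t -> (forall r, r \in rs -> z <= v t + xi t r) ->
  zbcdf t z = 0.
Proof.
move=> tin vz vxz; rewrite /zbcdf big_seq big1 ?mulr0 // => r rin.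
by rewrite !min_r ?vxz // subrr !mulr0.
Qed.

(** Outside the bad event the variable and its zero-biased version differ by at most
2 * delta. *)
Lemma indicator_zbcdf t r z : t \in ts -> ~~ bad t -> r \in rs ->
  zbcdf t (z - 2 * delta) <= (v t + xi t r <= z)%R%:R <= zbcdf t (z + 2 * delta).
Proof.
move=> tin gt rin; have xir := xi_le tin gt rin.
have shift d r' : r' \in rs -> 0 <= d -> `|xi t r| <= d -> `|xi t r'| <= d ->
    v t + xi t r' <= v t + xi t r + 2 * d /\ v t + xi t r - 2 * d <= v t + xi t r'.
  by move=> _ _; rewrite !ler_norml => /andP[? ?] /andP[? ?]; split; lra.
have shift0 d : 0 <= d -> `|xi t r| <= d ->
    v t <= v t + xi t r + 2 * d /\ v t + xi t r - 2 * d <= v t.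
  by move=> ?; rewrite !ler_norml => /andP[? ?]; split; lra.
have [z1 z2] := shift0 _ delta_ge0 xir.
have [xz|/ltW zx] := leP (v t + xi t r) z.
  apply/andP; split; first exact: zbcdf_le1.
  rewrite zbcdf_eq1 //; first by apply: le_trans z1 _; rewrite lerD2r.
  move=> r' r'in; have [h _] := shift _ _ r'in delta_ge0 xir (xi_le tin gt r'in).
  by apply: le_trans h _; rewrite lerD2r.
apply/andP; split; last exact: zbcdf_ge0.
rewrite zbcdf_eq0 //; first by apply: le_trans z2; rewrite lerD2r.
move=> r' r'in; have [_ h] := shift _ _ r'in delta_ge0 xir (xi_le tin gt r'in).
by apply: le_trans h; rewrite lerD2r.
Qed.

(** Sandwich the distribution function of v + xi between shifts by 2 * delta of the
zero-biased one, which is close to the Gaussian one by [zbcdf_Phi]. *)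
Theorem zero_bias_kolmogorov (z : R) :
  `|\sum_(t <- ts) m t * \sum_(r <- rs) p t r * (v t + xi t r <= z)%R%:R - Phi z|
  <= (2 * stein_bound R + 12) * delta + 3 * \sum_(t <- ts | bad t) m t.
Proof.
set Pr := \sum_(t <- ts) _; pose Q z := \sum_(t <- ts) m t * zbcdf t z.
have ind01 (b : bool) : 0 <= (b%:R : R) <= 1 by case: b; rewrite ?lexx ?ler01.
have upper : Pr <= Q (z + 2 * delta) + beta.
  rewrite -average_bad -big_split /= (eq_bigr (fun t => m t * (zbcdf t (z + 2 * delta) + (bad t)%:R))).
    apply: average_le => t tin; apply: row_average_le => // r rin.
    have [bt|gt] := boolP (bad t); last first.
      by rewrite addr0; have /andP[] := indicator_zbcdf z tin gt rin.
    have /andP[_ h] := ind01 (v t + xi t r <= z); apply: le_trans h _.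
    by rewrite lerDr zbcdf_ge0.
  by move=> t _; rewrite mulrDr.
have lower : Q (z - 2 * delta) - beta <= Pr.
  rewrite -average_bad -sumrB /= (eq_bigr (fun t => m t * (zbcdf t (z - 2 * delta) - (bad t)%:R))).
    apply: average_le => t tin; apply: le_row_average => // r rin.
    have [bt|gt] := boolP (bad t); last first.
      by rewrite subr0; have /andP[] := indicator_zbcdf z tin gt rin.
    have /andP[h _] := ind01 (v t + xi t r <= z); apply: le_trans h.
    by rewrite subr_le0 zbcdf_le1.
  by move=> t _; rewrite mulrBr.
have := zbcdf_Phi (z + 2 * delta); have := zbcdf_Phi (z - 2 * delta).
rewrite -!/(Q _) -/beta.
have d2 : 0 <= 2 * delta by rewrite mulr_ge0.
have := @Phi_lipschitz R z (z + 2 * delta) _; rewrite lerDl => /(_ d2).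
have := @Phi_lipschitz R (z - 2 * delta) z _; rewrite gerBl => /(_ d2).
move: delta beta Pr (Q (z + _)) (Q (z - _)) upper lower (Phi (z + _)) (Phi (z - _)) (Phi z) => d b Pr' Q1 Q2.
move=> u l f1 f2 f; rewrite !ler_norml => ? ? /andP[? ?] /andP[? ?]; apply/andP; split; lra.
Qed.
End ZeroBias.

(** * Partitions as padded lists *)

Definition padding (n : nat) (s : seq nat) : seq nat := s ++ nseq (n - size s) 0%N.

Lemma hook_cat0 (R : realFieldType) (alpha : R) s k :
  hook alpha (s ++ nseq k 0%N) = hook alpha s.
Proof.
elim: s => [|m s IH] /=.
  by elim: k => //= k ->; rewrite /rowhook big_nil mulr1.
rewrite IH; congr (_ * _); apply: eq_big_seq => d; rewrite mem_iota /= => dm.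
by rewrite count_cat count_nseq leqNgt dm /= mul0n addn0.
Qed.

Lemma contentsum_cat0 (R : realFieldType) (alpha : R) s k :
  contentsum alpha (s ++ nseq k 0%N) = contentsum alpha s.
Proof.
rewrite /contentsum size_cat iotaD big_cat /= [X in _ + X]big1_seq ?addr0; last first.
  move=> i; rewrite mem_iota add0n => /= /andP[si _].
  by rewrite nth_cat ltnNge si /= nth_nseq if_same big_nil.
by apply: eq_big_seq => i; rewrite mem_iota nth_cat /= => ->.
Qed.

Lemma hook_rows (R : realFieldType) (alpha : R) s :
  hook alpha s = \prod_(i <- iota 0 (size s)) rowhook alpha (nth 0%N s i) (drop i.+1 s) 0.
Proof.
elim: s => [|m s IH]; first by rewrite big_nil.
by rewrite iota0S big_cons big_map /= drop0 IH.
Qed.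

Lemma count_drop_nth (P : pred nat) (s : seq nat) k :
  count (fun i => (k <= i)%N && P (nth 0%N s i)) (iota 0 (size s)) = count P (drop k s).
Proof.
elim: s k => [|m s IH] k //; rewrite iota0S [LHS]/= count_map.
case: k => [|k] /=; last by rewrite -IH.
by rewrite -[in RHS](drop0 s) -IH.
Qed.

Lemma big_iota_rev (R : realFieldType) (m : nat) (F : nat -> R) :
  \prod_(d <- iota 0 m) F d = \prod_(j <- iota 0 m) F (m - j.+1)%N.
Proof.
have := @big_nat_rev R *%R 1 0%N m xpredT F.
by rewrite /index_iota subn0 add0n.
Qed.

Section Boxes.
Variables (n : nat) (L : intpart n).
Local Notation s := (parts L).

Lemma parts_intpart : is_intpart n s.
Proof. by rewrite /parts; case: L. Qed.

Lemma arm_row i j : (i < size s)%N -> arm L (i, j) = (nth 0 s i - j.+1)%N.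
Proof.
move=> si; rewrite /arm /boxes -sum1_count big_mkcond big_allpairs_dep /=.
have iin : i \in iota 0 (size s) by rewrite mem_iota.
rewrite (bigD1_seq i iin (iota_uniq _ _)) /= [X in (_ + X)%N]big1 ?addn0; last first.
  by move=> i' /negbTE ii'; rewrite big1 // => j' _; rewrite ii'.
rewrite eqxx; elim: (nth _ _ _) => [|m IH]; first by rewrite big_nil.
by rewrite iota0Sr big_rcons /= IH; case: ltnP; lia.
Qed.

Lemma leg_column i j : leg L (i, j) = count (fun q => j < q)%N (drop i.+1 s).
Proof.
rewrite /leg /boxes -sum1_count big_mkcond big_allpairs_dep /=.
have rowE i' : (\sum_(j' <- iota 0 (nth 0 s i')) (if (j' == j) && (i < i') then 1 else 0)
   = if (i < i') && (j < nth 0 s i') then 1 else 0)%N.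
  case: (ltnP i i') => ii'; last by rewrite big1 // => j' _; rewrite andbF.
  elim: (nth _ _ _) => [|m IH]; first by rewrite big_nil.
  rewrite iota0Sr big_rcons /= IH andbT eq_sym; case: (ltngtP j m) => /= ?; rewrite ?ltnS.
  - by rewrite ifT // ltnW.
  - by rewrite ifF //; lia.
  - by rewrite ifT //; lia.
rewrite (eq_bigr _ (fun i' _ => rowE i')) -big_mkcond sum1_count.
exact: (count_drop_nth (fun q => j < q)%N s i.+1).
Qed.

Lemma jackE (R : realType) (alpha : R) : jack alpha L = jackmass alpha (padding n s).
Proof.
have /and3P[_ _ /eqP sn] := parts_intpart.
rewrite /jack /jackmass /padding hook_cat0 sumn_cat sumn_nseq mul0n addn0 sn.
congr (_ / _); rewrite /boxes big_allpairs_dep hook_rows; apply: eq_big_seq => i.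
rewrite mem_iota /= => si; rewrite /rowhook big_iota_rev; apply: eq_big_seq => j.
rewrite mem_iota /= => jsi; rewrite arm_row // leg_column /hookpair addr0.
rewrite (eq_count (a2 := fun q => (j < q)%N)) // => q /=; lia.
Qed.

Lemma jackYE (R : realType) (alpha : R) : jackY alpha L = contentsum alpha (padding n s).
Proof.
by rewrite /jackY /boxes big_allpairs_dep /padding contentsum_cat0.
Qed.
End Boxes.

Lemma padding_strip s : sorted geq s -> padding (size s) (seq.filter (leq 1) s) = s.
Proof.
rewrite /padding; elim: s => // [[|m] s] IH /sorted_geq_cons[sm ss] /=.
  have s0 : s = nseq (size s) 0%N.
    by apply/all_pred1P; apply: sub_all sm => q /=; lia.
  rewrite (_ : seq.filter _ s = [::]) ?subn0 //=; first by rewrite -s0.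
  by rewrite s0; elim: (size s).
by rewrite subSS IH.
Qed.

Lemma strip_padding n s : all (leq 1) s -> seq.filter (leq 1) (padding n s) = s.
Proof.
move=> s1; rewrite /padding filter_cat (all_filterP s1).
by rewrite (_ : seq.filter _ (nseq _ _) = [::]) ?cats0 //; elim: (n - size s)%N.
Qed.

(** Padding with zeros is a bijection from partitions, as lists of positive parts, to
[padded n n]; it is undone by filtering out the zeros. *)
Lemma perm_padded_parts n :
  perm_eq [seq padding n (parts L) | L <- index_enum (intpart n)] (padded n n).
Proof.
have size_parts (L : intpart n) : (size (parts L) <= n)%N.
  by rewrite size_map; exact: size_bseq.
apply: uniq_perm; [|exact: padded_uniq|].
  rewrite map_inj_uniq ?index_enum_uniq // => L L' E; apply: val_inj; apply: val_inj.
  have /and3P[_ p1 _] := parts_intpart L; have /and3P[_ p1' _] := parts_intpart L'.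
  by apply: (inj_map val_inj); rewrite -[LHS](strip_padding n p1) E strip_padding.
move=> s; rewrite mem_padded //; apply/mapP/and3P.
  case=> L _ ->; have /and3P[sL _ /eqP sn] := parts_intpart L.
  rewrite /padding size_cat size_nseq subnKC // sumn_cat sumn_nseq mul0n addn0 sn !eqxx.
  split=> //; apply/sorted_geqP => i; rewrite !nth_cat !nth_nseq !if_same.
  case: (ltnP i.+1 (size (parts L))) => // iL; rewrite (ltnW iL).
  by move/sorted_geqP: sL; apply.
case=> /eqP sn ss /eqP sk; set u := seq.filter (leq 1) s.
have un : (size u <= n)%N by rewrite -sn size_filter count_size.
have uE : [seq val i | i <- [seq inord m : 'I_n.+1 | m <- u]] = u.
  rewrite -map_comp -[RHS]map_id; apply/eq_in_map => m.
  rewrite mem_filter => /andP[_ /(nthP 0%N)[i _ <-]] /=.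
  by rewrite inordK // ltnS -sk leq_nth_sumn.
have bu : (size [seq inord m : 'I_n.+1 | m <- u] <= n)%N by rewrite size_map.
have pu : is_intpart n [seq val i | i <- Bseq bu].
  rewrite /= uE /is_intpart filter_all /=; apply/andP; split.
    apply: sorted_filter ss => a b c ab bc; exact: leq_trans bc ab.
  have := congr1 sumn (padding_strip ss); rewrite sn sk /padding sumn_cat sumn_nseq mul0n addn0.
  by move=> /eqP.
exists (IntPart pu); first exact: mem_index_enum.
by rewrite /parts /= uE -[LHS](padding_strip ss) sn.
Qed.

Lemma jack_prob_expect (R : realType) (alpha : R) (n : nat) (P : pred R) :
  jack_prob alpha (fun L : intpart n => P (jackY alpha L))
  = expect alpha n n (fun s => (P (contentsum alpha s))%:R).
Proof.
rewrite /jack_prob /expect -(perm_big _ (perm_padded_parts n)) big_map /= big_mkcond.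
by apply: eq_bigr => L _; rewrite -jackE -jackYE; case: (P _); rewrite ?mulr1 ?mulr0.
Qed.

(** * The Jack measure *)

Lemma long_row_prob (R : realType) (alpha : R) (n k L : nat) : 0 < alpha -> (k <= n)%N ->
  \sum_(t <- padded n k | (L < nth 0 t 0)%N) jackmass alpha t <= k%:R * (n%:R / alpha) ^+ L.
Proof.
move=> a0 kn; apply: le_trans (expect_long_rows a0 L kn).
rewrite big_mkcond /expect; apply: ler_sum => t _.
case: ifP => Lt; last by rewrite mulr_ge0 // ltW // jackmass_gt0.
apply: ler_peMr; first exact/ltW/jackmass_gt0.
rewrite ler1n -has_count.
by case: t Lt => //= m t ->.
Qed.

Lemma sqr_natr_binomial (R : realType) (k : nat) :
  'C(k.+1, 2)%:R = k.+1%:R * k%:R / 2 :> R.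
Proof.
have := congr1 (fun m => m%:R : R) (mul_bin_diag k.+1 1).
by rewrite /= bin1 !natrM => ->; field.
Qed.

(** The last step of the growth process is a zero-bias coupling: v is the content
sum of the diagram of size k, xi the content of the last box, and a diagram is bad
when its first row is longer than L. *)
Lemma jack_kolmogorov (R : realType) (alpha : R) (k L : nat) (z : R) :
  (0 < k)%N -> (0 < L)%N -> k.+1%:R <= alpha ->
  `|jack_prob alpha (fun M : intpart k.+1 => jackW alpha M <= z) - Phi z|
   <= (2 * stein_bound R + 12) * (alpha * L%:R / Num.sqrt (alpha * 'C(k.+1, 2)%:R))
      + 3 * (k%:R * (k.+1%:R / alpha) ^+ L).
Proof.
move=> k0 L0 na; set sigma := Num.sqrt (alpha * 'C(k.+1, 2)%:R).
have a0 : 0 < alpha by apply: lt_le_trans na; rewrite ltr0n.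
have C0 : 0 <= stein_bound R by have := phiV_gt0 (1 : R); rewrite /stein_bound; lra.
have kR : 0 < k%:R :> R by rewrite ltr0n.
have nR : 0 < k.+1%:R :> R by rewrite ltr0n.
have sigma2 : sigma ^+ 2 = alpha * (k.+1%:R * k%:R / 2).
  rewrite /sigma sqr_sqrtr ?sqr_natr_binomial //.
  apply: mulr_ge0; first exact: ltW.
  by rewrite !mulr_ge0 ?invr_ge0.
have sigma0 : 0 < sigma by rewrite sqrtr_gt0 mulr_gt0 // ltr0n bin_gt0.
have sigmaN0 : sigma != 0 by rewrite gt_eqF.
set delta := alpha * L%:R / sigma.
have delta0 : 0 <= delta by rewrite divr_ge0 ?mulr_ge0 // ltW.
rewrite /jackW (jack_prob_expect alpha k.+1 (fun y => y / sigma <= z)).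
have tail0 : 0 <= k%:R * (k.+1%:R / alpha) ^+ L.
  by rewrite mulr_ge0 // exprn_ge0 // divr_ge0 // ltW.
(* For delta > 1 the bound exceeds the trivial one. *)
have [delta1|delta1] := leP delta 1; last first.
  apply: (@le_trans _ _ 1).
    have := Phi_ge0 z; have := Phi_le1 z.
    have : 0 <= expect alpha k.+1 k.+1 (fun s => (contentsum alpha s / sigma <= z)%R%:R).
      by apply: sumr_ge0 => s _; rewrite mulr_ge0 // ltW // jackmass_gt0.
    have : expect alpha k.+1 k.+1 (fun s => (contentsum alpha s / sigma <= z)%R%:R) <= 1.
      rewrite -[leRHS](@expect1 R alpha k.+1 a0 k.+1) //.
      by apply: le_expect => // s _ _ _; case: (_ <= z); rewrite ?ler01.
    by rewrite ler_norml => ? ? ? ?; apply/andP; split; lra.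
  by nra.
have split_content t r : t \in padded k.+1 k -> r \in iota 0 k.+1 ->
  contentsum alpha (incr_nth t r) / sigma = contentsum alpha t / sigma + xrow alpha t r / sigma.
  rewrite mem_padded // mem_iota /= => /and3P[/eqP tn _ _] rn.
  by rewrite contentsum_incr ?tn // mulrDl.
have moment t e : t \in padded k.+1 k -> (e <= 2)%N ->
  \sum_(r <- iota 0 k.+1) upw alpha k.+1 t r * (xrow alpha t r / sigma) ^+ e =
  match e with 0%N => 1 | 1%N => 0 | _ => 2 / k.+1%:R end.
  rewrite mem_padded // => /and3P[/eqP tn st /eqP tk] e2.
  have := @upw_moment_lt R alpha k.+1 a0 t e _ st tn e2; rewrite tk => /(_ (ltnSn k)) M.
  transitivity ((\sum_(r <- iota 0 k.+1) upw alpha k.+1 t r * xrow alpha t r ^+ e) / sigma ^+ e).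
    by rewrite mulr_suml; apply: eq_bigr => r _; rewrite expr_div_n mulrA.
  rewrite {}M; case: e e2 => [|[|[|//]]] _; rewrite ?expr0 ?divr1 ?mul0r // sigma2.
  by field; rewrite !gt_eqF.
rewrite (expect_grow a0) //.
have -> : expect alpha k.+1 k (fun t => \sum_(r <- iota 0 k.+1) upw alpha k.+1 t r *
     (contentsum alpha (incr_nth t r) / sigma <= z)%R%:R) =
  \sum_(t <- padded k.+1 k) jackmass alpha t * \sum_(r <- iota 0 k.+1) upw alpha k.+1 t r *
     (contentsum alpha t / sigma + xrow alpha t r / sigma <= z)%R%:R.
  apply: eq_big_seq => t tin; congr (_ * _); apply: eq_big_seq => r rin.
  by rewrite split_content.
apply: le_trans (_ : _ <= (2 * stein_bound R + 12) * delta + 3 *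
  \sum_(t <- padded k.+1 k | (L < nth 0 t 0)%N) jackmass alpha t) _; last first.
  by rewrite lerD2l ler_wpM2l // long_row_prob.
apply: (@zero_bias_kolmogorov R _ (padded k.+1 k) _ (iota 0 k.+1) (jackmass alpha)
  (upw alpha k.+1) (fun t r => xrow alpha t r / sigma) (fun t => contentsum alpha t / sigma)
  (fun t => L < nth 0 t 0)%N (2 / k.+1%:R) delta) => //.
- by move=> t _; rewrite ltW // jackmass_gt0.
- have := @expect1 R alpha k.+1 a0 k (leqnSn k); rewrite /expect => <-.
  by apply: eq_bigr => t _; rewrite mulr1.
- have := @expect_contentsum_sqr R alpha k.+1 a0 k (leqnSn k); rewrite /expect => E.
  rewrite (eq_bigr (fun t => (jackmass alpha t * contentsum alpha t ^+ 2) / sigma ^+ 2)); last first.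
    by move=> t _; rewrite expr_div_n mulrA.
  rewrite -mulr_suml E sigma2 ler_pdivrMr; last by rewrite !mulr_gt0 // invr_gt0.
  rewrite mul1r ler_pM2l // ler_pM2r ?invr_gt0 // [leRHS]mulrC ler_pM2l // -natr1.
  by lra.
- move=> t r; rewrite mem_padded // mem_iota /= => /and3P[/eqP tn st _] rn.
  by rewrite -tn upw_ge0 // tn.
- move=> t tin; have := moment t 0%N tin isT => <-.
  by apply: eq_bigr => r _; rewrite expr0 mulr1.
- move=> t tin; exact: (moment t 1%N tin isT).
- move=> t tin; exact: (moment t 2%N tin isT).
- move=> t r; rewrite mem_padded // mem_iota /= -leqNgt => /and3P[_ st _] tL rn.
  rewrite normrM [`|sigma^-1|]ger0_norm ?invr_ge0 ?(ltW sigma0) // ler_wpM2r ?invr_ge0 ?(ltW sigma0) //.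
  have h1 : (nth 0%N t r)%:R <= L%:R :> R.
    by rewrite ler_nat (leq_trans _ tL) // nth_geq.
  have h2 : r%:R <= k.+1%:R :> R by rewrite ler_nat ltnW.
  have h3 : 1 <= L%:R :> R by rewrite ler1n.
  have h4 : 0 <= (nth 0%N t r)%:R :> R by [].
  have h5 : 0 <= r%:R :> R by [].
  have h6 := ler_wpM2l (ltW a0) h1; have h7 := ler_wpM2l (ltW a0) h3.
  have h8 := mulr_ge0 (ltW a0) h4.
  rewrite /xrow ler_norml; apply/andP; split; lra.
- move=> f; have kn : (k < k.+1)%N by [].
  have := @expect_grow_content R alpha k.+1 a0 k (fun s => f (contentsum alpha s / sigma)) kn.
  have := @expect_grow R alpha k.+1 a0 k
     (fun s => contentsum alpha s / sigma * f (contentsum alpha s / sigma)) kn.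
  rewrite /expect.
  rewrite [X in _ = X -> _](_ : _ = \sum_(t <- padded k.+1 k) jackmass alpha t *
    \sum_(r <- iota 0 k.+1) upw alpha k.+1 t r *
    ((contentsum alpha t / sigma + xrow alpha t r / sigma) *
    f (contentsum alpha t / sigma + xrow alpha t r / sigma))); last first.
    apply: eq_big_seq => t tin; congr (_ * _); apply: eq_big_seq => r rin.
    by rewrite split_content.
  move=> <- B; apply: (@mulfI _ (2 / k.+1%:R)); first by rewrite gt_eqF // divr_gt0.
  rewrite mulrA divff ?mul1r; last by rewrite gt_eqF // divr_gt0.
  rewrite [RHS](_ : _ = (\sum_(t <- padded k.+1 k) jackmass alpha t *
    \sum_(r <- iota 0 k.+1) upw alpha k.+1 t r *
      (xrow alpha t r * f (contentsum alpha (incr_nth t r) / sigma))) / sigma); last first.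
    rewrite mulr_suml; apply: eq_big_seq => t tin; rewrite -mulrA; congr (_ * _).
    rewrite mulr_suml; apply: eq_big_seq => r rin; rewrite split_content //; ring.
  rewrite B -[RHS]mulrA; congr (_ * _).
  by rewrite mulr_suml; apply: eq_bigr => s _; ring.
Qed.

(** With alpha >= n * n ^ eps the bound of [expect_long_rows] is at most
n * n ^ (- eps * L), and L is chosen so that eps * L >= 2. *)
Lemma long_row_tail (R : realType) (eps alpha : R) (n L : nat) : 0 < eps -> 2 <= eps * L%:R ->
  (0 < n)%N -> n%:R `^ (1 + eps) <= alpha -> n%:R * (n%:R / alpha) ^+ L <= n%:R^-1.
Proof.
move=> eps0 epsL n0 nalpha.
have nR : 0 < n%:R :> R by rewrite ltr0n.
have n1 : 1 <= n%:R :> R by rewrite ler1n.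
have ne0 : 0 < n%:R `^ eps by rewrite powR_gt0.
have nE : n%:R `^ (1 + eps) = n%:R * n%:R `^ eps.
  by rewrite powRD ?powRr1 ?ltW //; apply/implyP => _; rewrite gt_eqF.
have a0 : 0 < alpha by apply: lt_le_trans nalpha; rewrite powR_gt0.
have q : n%:R / alpha <= (n%:R `^ eps)^-1.
  by rewrite ler_pdivrMr // mulrC ler_pdivlMr // -nE.
have : (n%:R / alpha) ^+ L <= (n%:R `^ eps)^-1 ^+ L.
  by rewrite lerXn2r // nnegrE ?invr_ge0 ?divr_ge0 ?ltW.
have pE : (n%:R `^ eps) ^+ L = n%:R `^ (eps * L%:R) :> R.
  by rewrite powRrM powR_mulrn // ltW.
rewrite exprVn pE => qL.
have nL : n%:R ^+ 2 <= n%:R `^ (eps * L%:R).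
  by rewrite -(powR_mulrn 2 (ltW nR)); exact: ler_powR.
apply: le_trans (_ : _ <= n%:R * (n%:R ^+ 2)^-1) _.
  apply: ler_wpM2l; first exact: ltW.
  apply: le_trans qL _; rewrite lef_pV2 ?posrE ?powR_gt0 ?exprn_gt0 //.
by rewrite expr2 invfM mulrA divff ?mul1r // gt_eqF.
Qed.

Theorem theorem1p5 (R : realType) (eps : R) (eps_gt0 : 0 < eps)
    (eps_lt1 : eps < 1) :
  exists C : R, forall (n : nat) (alpha : R),
    (2 <= n)%N -> n%:R `^ (1 + eps) <= alpha ->
    (ereal_sup [set `|(jack_prob alpha
                         (fun L : intpart n => jackW alpha L <= z)%R)%:E
                      - normal_prob (0 : R) 1 [set t | (t <= z)%R]| | z in [set: R]]
     <= (C * Num.sqrt alpha / n%:R)%:E)%E.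
Proof.
pose L := (Num.truncn (2 / eps)).+1.
have epsL : 2 <= eps * L%:R.
  by rewrite mulrC -ler_pdivrMr // ltW // truncnS_gt.
(* 2 * L * sqrt alpha / n bounds alpha * L / sigma; the summand 3 covers the long rows. *)
exists ((2 * stein_bound R + 12) * (2 * L%:R) + 3) => n alpha n2 nalpha.
apply: ub_ereal_sup => _ [z _ <-].
have -> : [set t | (t <= z)%R] = `]-oo, z]%classic.
  by apply/seteqP; split => t /=; rewrite in_itv.
rewrite PhiE -EFinB abse_EFin lee_fin.
have n1 : 1 <= n%:R :> R by rewrite ler1n ltnW.
have nR : 0 < n%:R :> R by rewrite ltr0n ltnW.
have na : n%:R <= alpha.
  by apply: le_trans nalpha; rewrite -[leLHS]powRr1 ?ler_powR //; lra.
have a0 : 0 < alpha by exact: lt_le_trans na.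
have a1 : 1 <= Num.sqrt alpha.
  by rewrite -[leLHS]sqrtr1 ler_sqrt ?(ltW a0) //; exact: le_trans na.
have C0 : 0 <= stein_bound R by have := phiV_gt0 (1 : R); rewrite /stein_bound; lra.
have tail := long_row_tail eps_gt0 epsL (ltnW n2) nalpha.
case: n n2 nalpha n1 nR na tail => // k n2 nalpha n1 nR na tail.
have k0 : (0 < k)%N by [].
apply: le_trans (@jack_kolmogorov R alpha k L z k0 isT na) _.
rewrite -[leRHS]mulrA [leRHS]mulrDl; apply: lerD.
  rewrite -[leRHS]mulrA; apply: ler_wpM2l; first by lra.
  (* With n = k + 1, this is n ^ 2 / 4 <= n * (n - 1) / 2, which needs n >= 2. *)
  have sb : k.+1%:R / 2 <= Num.sqrt 'C(k.+1, 2)%:R :> R.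
    have h0 : 0 <= k.+1%:R / 2 :> R by rewrite divr_ge0.
    rewrite -(ger0_norm h0) -sqrtr_sqr ler_sqrt // sqr_natr_binomial.
    have : 1 <= k%:R :> R by rewrite ler1n.
    by rewrite -natr1; move: (k%:R) => x; nra.
  have sa0 : 0 < Num.sqrt alpha by rewrite sqrtr_gt0.
  have sq : alpha = Num.sqrt alpha * Num.sqrt alpha by rewrite -expr2 sqr_sqrtr // ltW.
  have C2 : 0 < Num.sqrt 'C(k.+1, 2)%:R :> R by apply: lt_le_trans sb; rewrite divr_gt0.
  rewrite sqrtrM ?(ltW a0) // ler_pdivrMr ?mulr_gt0 // {1}sq.
  rewrite [leRHS](_ : _ = L%:R * (Num.sqrt alpha * Num.sqrt alpha) *
     (2 * Num.sqrt 'C(k.+1, 2)%:R / k.+1%:R)); last by ring.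
  rewrite [leLHS]mulrC ler_peMr ?mulr_ge0 ?(ltW sa0) // ler_pdivlMr // mul1r.
  by move: sb; rewrite ler_pdivrMr // mulrC.
apply: ler_wpM2l => //; apply: (@le_trans _ _ (k.+1%:R^-1)).
  apply: le_trans tail; apply: ler_wpM2r; last by rewrite ler_nat.
  by rewrite exprn_ge0 // divr_ge0 // ltW.
by rewrite ler_peMl ?invr_ge0.
Qed.
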